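(* Let $q,d,M\in\mathbb{N}$, $D=(2q+1)^d$, and let $N$ be a prime number with $$N\ge\max\{2q+1,\ (d-1)^2(2M-1)^2+1\}.$$ Let $X=\{x_1,\ldots,x_N\}$ with $x_j=(j,j^2,\ldots,j^d)/N \bmod 1$, $j=1,\ldots,N$, and let $\mathcal F_X$ be the $N\times D$ matrix with entries $(\mathcal F_X)_{j,k}=\exp(2\pi i\,k\cdot x_j)$, $k\in[-q,q]^d\cap\mathbb{Z}^d$. Then for every $f\in\Pi_q^d(M)$ with coefficient vector $c$, given the samples $y=(f(x_j))_{j=1}^N=\mathcal F_X c$: (i) Orthogonal Matching Pursuit run for $M$ iterations with input $\mathcal F_X$ and $y$ returns exactly $c$; and (ii) Basis Pursuit, i.e. the problem $\min\{\|z\|_1: z\in\mathbb{C}^D,\ \mathcal F_X z=y\}$, has $c$ as its unique solution.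
   Context: $\Pi_q^d$ is the space of trigonometric polynomials $f(x)=\sum_{k\in[-q,q]^d\cap\mathbb{Z}^d}c_k e^{2\pi i k\cdot x}$, $x\in[0,1]^d$, $c_k\in\mathbb{C}$. For $T\subset[-q,q]^d\cap\mathbb{Z}^d$, $\Pi_T$ denotes those $f$ with $c_k=0$ for $k\notin T$, and $\Pi_q^d(M)=\bigcup_{|T|\le M}\Pi_T$ (the $M$-sparse trigonometric polynomials). Orthogonal Matching Pursuit (OMP): set $r^0=y$, $\Lambda^0=\emptyset$; for $\ell=0,1,\ldots,M-1$: compute $h^\ell=\mathcal F_X^* r^\ell$ ($\mathcal F_X^*$ the conjugate transpose), set $\Lambda^{\ell+1}=\Lambda^\ell\cup\{\arg\max_k |h^\ell(k)|\}$, let $c^{\ell+1}=\arg\min_{z:\,\mathrm{supp}(z)\subset\Lambda^{\ell+1}}\|y-\mathcal F_X z\|_2$, and $r^{\ell+1}=y-\mathcal F_X c^{\ell+1}$; output $c^M$. *)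

(* Defs.v *)
(* Complex numbers are modelled by an arbitrary
   numClosedFieldType C (e.g. the algebraic complex numbers algC, or C itself). *)
From HB Require Import structures.
From mathcomp Require Import all_boot all_order all_algebra.
Set Implicit Arguments. Unset Strict Implicit. Unset Printing Implicit Defensive.
Import Order.TTheory GRing.Theory Num.Theory.
Local Open Scope ring_scope.

(* Frequency index set [-q,q]^d ∩ Z^d: k is encoded as a finite function
   'I_d -> 'I_(2q+1), the l-th coordinate being (k l) - q. *)
Definition Kidx (q d : nat) : finType := {ffun 'I_d -> 'I_(2 * q + 1)}.
Definition kcoord (q d : nat) (k : Kidx q d) (l : 'I_d) : int := (k l)%:Z - q%:Z.

Definition cvec (C : numClosedFieldType) (q d : nat) := {ffun Kidx q d -> C}.
Definition svec (C : numClosedFieldType) (N : nat) := {ffun 'I_N -> C}.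

(* omega = exp(2 pi i / N): N.-root (-1) is the N-th root of -1 with largest
   real part among those with nonnegative imaginary part, i.e. exp(i pi / N). *)
Definition omega (C : numClosedFieldType) (N : nat) : C := (N.-root (-1)) ^+ 2.

(* Node x_j, j = i+1 in 1..N: l-th coordinate (l = 1..d) is (j^l mod N)/N.
   k . x_j = (sum_l k_l * (j^l mod N)) / N, so exp(2 pi i k.x_j) = omega^(...). *)
Definition kdotxN (q d N : nat) (i : 'I_N) (k : Kidx q d) : int :=
  \sum_(l < d) kcoord k l * (((i.+1) ^ (l.+1)) %% N)%N%:Z.

Definition FX (C : numClosedFieldType) (q d N : nat) (i : 'I_N) (k : Kidx q d) : C :=
  omega C N ^ kdotxN i k.

Definition FXmul (C : numClosedFieldType) (q d N : nat) (z : cvec C q d) : svec C N :=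
  [ffun i => \sum_k FX C i k * z k].
Definition FXadj (C : numClosedFieldType) (q d N : nat) (r : svec C N) : cvec C q d :=
  [ffun k => \sum_i (FX C i k)^* * r i].

Definition supp (C : numClosedFieldType) (q d : nat) (z : cvec C q d) : {set Kidx q d} :=
  [set k | z k != 0].

Definition l1norm (C : numClosedFieldType) (q d : nat) (z : cvec C q d) : C :=
  \sum_k `|z k|.
Definition l2norm (C : numClosedFieldType) (N : nat) (v : svec C N) : C :=
  sqrtC (\sum_i `|v i| ^+ 2).

(* A run of Orthogonal Matching Pursuit for M iterations on input (F_X, y):
   Lam l = Lambda^l, cs l = c^l (with c^0 = 0, so r^0 = y), residual
   r^l = y - F_X c^l.  Ties in the argmax and non-uniqueness of the least
   squares minimizer are allowed arbitrarily (any choice gives a run). *)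
Definition omp_run (C : numClosedFieldType) (q d N M : nat) (y : svec C N)
    (Lam : nat -> {set Kidx q d}) (cs : nat -> cvec C q d) : Prop :=
  Lam 0%N = set0 /\ cs 0%N = 0 /\
  forall l : nat, (l < M)%N ->
    let r := y - FXmul N (cs l) in
    let h := FXadj q d r in
    (exists kmax : Kidx q d,
        (forall k, `|h k| <= `|h kmax|) /\ Lam l.+1 = kmax |: Lam l) /\
    supp (cs l.+1) \subset Lam l.+1 /\
    (forall z : cvec C q d, supp z \subset Lam l.+1 ->
        l2norm (y - FXmul N (cs l.+1)) <= l2norm (y - FXmul N z)).

(* Main.v *)
Require Import Defs.
From HB Require Import structures.
From mathcomp Require Import all_boot all_order all_algebra all_field.
From mathcomp Require Import ring zify.
Import Order.TTheory GRing.Theory Num.Theory.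

(* By the theory of sparse recovery from incoherent columns, it suffices that
   distinct columns of F_X have inner product at most (d - 1) sqrt N in modulus:
   then (2 M - 1) (d - 1) sqrt N < N.  The inner product of the columns k and k'
   is the exponential sum \sum_x psi (f x) over F_N, where f has coefficients
   k'_l - k_l, so this is Weil's bound.

   For Weil's bound, let S_n be the sum of psi (Tr (f x)) over the field with
   p ^ n elements.  The L-function \sum_g lambda(g) t ^ deg g, over monic g, is a
   polynomial of degree d - 1 because lambda(g) depends on the d-th highest
   coefficient of g through a nontrivial character; its logarithmic derivative
   has coefficients S_n, so S_n = - \sum w_i ^ n for d - 1 numbers w_i.
   Stepanov's method bounds the fibres of Tr (f x), giving
   S_(2 n) = O(p ^ n), which forces |w_i| <= sqrt p, and |S_1| <= (d - 1) sqrt p.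
   All the extension fields live in one algebraic closure of F_p.  As C need not
   be archimedean, the last implication uses that the w_i are algebraic. *)
Set Implicit Arguments. Unset Strict Implicit. Unset Printing Implicit Defensive.
Local Open Scope ring_scope.

(** * Newton's identities and power sums *)

Section Newton.
Variable R : comNzRingType.
Implicit Types (rs : seq R) (k : nat).

(** The reversal of the monic polynomial with roots [rs]: its [k]-th coefficient is [(-1)^k] times
    the [k]-th elementary symmetric function. *)
Definition epoly rs : {poly R} := \prod_(r <- rs) (1 - r *: 'X).
Definition psum rs k : R := \sum_(r <- rs) r ^+ k.

Lemma coef_epoly_cons r rs k :
  (epoly (r :: rs))`_k = (epoly rs)`_k - r * (if k is k'.+1 then (epoly rs)`_k' else 0).
Proof.
rewrite /epoly big_cons mulrBl mul1r coefB -scalerAl coefZ coefXM.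
by case: k.
Qed.

(** The coefficient of [X^k] in [r / (1 - r X) * epoly (r :: rs) = r * epoly rs]. *)
Lemma epoly_geom r rs k :
  \sum_(j < k.+1) r ^+ j.+1 * (epoly (r :: rs))`_(k - j) = r * (epoly rs)`_k.
Proof.
elim: k => [|k IHk].
  by rewrite big_ord1 subn0 coef_epoly_cons mulr0 subr0 expr1.
rewrite big_ord_recl subn0 expr1.
under eq_bigr => j _ do rewrite /bump /= subSS exprS -mulrA.
rewrite -big_distrr /= IHk coef_epoly_cons; ring.
Qed.

(** With [E = epoly rs], this is [X E' = - E * \sum_(j > 0) psum rs j X^j] read coefficientwise.
    Induction on [rs] avoids division, so it serves both in characteristic [p] and over [C]. *)
Lemma newton rs k :
  k%:R * (epoly rs)`_k + \sum_(j < k) psum rs j.+1 * (epoly rs)`_(k - j.+1) = 0.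
Proof.
elim: rs k => [|r rs IHrs] k.
  rewrite big1 => [|j _]; last by rewrite /psum big_nil mul0r.
  rewrite addr0 /epoly big_nil coef1; case: k => [|k]; first by rewrite mul0r.
  by rewrite mulr0.
case: k => [|k]; first by rewrite big_ord0 mul0r addr0.
(* The contribution of [r] is evaluated by [epoly_geom]; the rest expands through the factor
   [1 - r X], which leaves the identities for [rs] at [k + 1] and [k]. *)
have -> : \sum_(j < k.+1) psum (r :: rs) j.+1 * (epoly (r :: rs))`_(k.+1 - j.+1)
  = r * (epoly rs)`_k
    + (\sum_(j < k.+1) psum rs j.+1 * (epoly rs)`_(k.+1 - j.+1)
       - r * \sum_(j < k) psum rs j.+1 * (epoly rs)`_(k - j.+1)).
  rewrite -epoly_geom.
  under eq_bigr => j _ do rewrite subSS /psum big_cons mulrDl.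
  rewrite big_split /=; congr (_ + _).
  rewrite !big_ord_recr /= !subnn coef_epoly_cons mulr0 subr0.
  rewrite addrAC; congr (_ + _); rewrite big_distrr /= -sumrB.
  apply: eq_bigr => j _; rewrite coef_epoly_cons subSS.
  have [i kj] : exists i, (k - j)%N = i.+1.
    by exists (k - j.+1)%N; rewrite -subSn ?subSS.
  by rewrite subnS kj /= /psum; ring.
have := IHrs k.+1; have := IHrs k; rewrite coef_epoly_cons.
move=> /(canRL (addKr _)) -> /(canRL (addKr _)) ->.
by rewrite -natr1; ring.
Qed.

Lemma epoly_top rs k : (size rs < k)%N -> (epoly rs)`_k = 0.
Proof.
elim: rs k => [|r rs IHrs] [|k] //= lek; first by rewrite /epoly big_nil coef1.
by rewrite coef_epoly_cons !IHrs ?mulr0 ?subr0 // ltnW.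
Qed.

Lemma coef_epoly_prod rs k : (k <= size rs)%N ->
  (\prod_(r <- rs) ('X - r%:P))`_(size rs - k) = (epoly rs)`_k.
Proof.
elim: rs k => [|r rs IHrs] k /=.
  by rewrite leqn0 => /eqP ->; rewrite /epoly !big_nil.
have top : (\prod_(r <- rs) ('X - r%:P))`_(size rs).+1 = 0.
  by apply: nth_default; rewrite size_prod_XsubC.
rewrite big_cons mulrBl coefB coefXM coefCM coef_epoly_cons leq_eqVlt ltnS.
case/predU1P => [->|lek].
  rewrite subnn /= -(IHrs _ (leqnn _)) subnn sub0r.
  suff -> : (epoly rs)`_(size rs).+1 = 0 by rewrite sub0r.
  exact: epoly_top.
rewrite subSn //= IHrs //; case: k lek => [|k] lek; first by rewrite subn0 top.
by rewrite -subSn // subSS IHrs // ltnW.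
Qed.

Lemma epoly0 rs : (epoly rs)`_0 = 1.
Proof. by elim: rs => [|r rs IH]; rewrite ?coef_epoly_cons ?IH ?mulr0 ?subr0 // /epoly big_nil coef1. Qed.

(** As a power series [A] has constant term [1], so it is not a zero divisor. *)
Lemma conv_eq0 (s : nat -> R) (A : nat -> R) : A 0%N = 1 ->
  (forall n, \sum_(j < n) s j * A (n - j.+1)%N = 0) -> forall n, s n = 0.
Proof.
move=> A0 H n; elim/ltn_ind: n => n IHn.
have := H n.+1; rewrite big_ord_recr /= subnn A0 mulr1 big1 ?add0r // => j _.
by rewrite IHn ?mul0r.
Qed.

End Newton.

(** * Bounds for algebraic elements of a possibly non-archimedean field *)

Section Archimedean.
Variable C : numClosedFieldType.
Implicit Types x y : C.

Definition algQ x := integralOver (ratr : rat -> C) x.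

Lemma algQ_nat n : algQ n%:R.
Proof. exact: integral_nat. Qed.

Lemma algQ_sum (I : eqType) (r : seq I) (F : I -> C) :
  (forall i, i \in r -> algQ (F i)) -> algQ (\sum_(i <- r) F i).
Proof.
elim: r => [|i r IH] H; first by rewrite big_nil; apply: (algQ_nat 0).
rewrite big_cons; apply: integral_add; first by apply: H; rewrite mem_head.
by apply: IH => j jr; apply: H; rewrite inE jr orbT.
Qed.

Lemma algQ_conj x : algQ x -> algQ x^*.
Proof.
case=> p pm /rootP px; exists p => //; apply/rootP.
have -> : map_poly ratr p = map_poly Num.conj (map_poly ratr p) :> {poly C}.
  by rewrite -map_poly_comp; apply: eq_map_poly => a /=; rewrite fmorph_div !rmorph_int.
by rewrite horner_map px rmorph0.
Qed.

(** Cauchy's bound on the roots of a monic polynomial is rational here, and the rationals are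
    archimedean. *)
Lemma algQ_bounded x : algQ x -> exists n : nat, `|x| <= n%:R.
Proof.
case=> p p_mon px.
pose S : rat := 1 + \sum_(i < size p) `|p`_i|.
have S_le : `|x| <= ratr S.
  have S1 : (1 : C) <= ratr S.
    by rewrite -(rmorph1 (@ratr C)) ler_rat lerDl sumr_ge0.
  have xreal : `|x| \is Num.real by apply: normr_real.
  have /orP[le1|ge1] := real_comparable xreal (real1 C); first exact: le_trans S1.
  have sp : (0 < size p)%N by rewrite size_poly_gt0 monic_neq0.
  move: px; rewrite /root horner_coef size_map_poly -(prednK sp) big_ord_recr /=.
  rewrite addrC addr_eq0 coef_map /= -lead_coefE (monicP p_mon) rmorph1 mul1r => /eqP px.
  case E: (size p).-1 px => [|m] px.
    by move: px; rewrite big_ord0 expr0 oppr0 => /eqP; rewrite oner_eq0.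
  have xm0 : 0 < `|x| ^+ m by rewrite exprn_gt0 // (lt_le_trans ltr01).
  rewrite -(ler_pM2r xm0) -exprS -normrX px normrN.
  apply: le_trans (ler_norm_sum _ _ _) _.
  apply: (@le_trans _ _ (\sum_(i < m.+1) (ratr `|p`_i| : C) * `|x| ^+ m)).
    apply: ler_sum => i _; rewrite coef_map normrM normrX ratr_norm.
    by apply: ler_wpM2l => //; rewrite ler_weXn2l // -ltnS.
  rewrite -mulr_suml ler_pM2r // -rmorph_sum ler_rat /S -(prednK sp) E.
  by rewrite [leRHS]addrC [X in _ <= X + _]big_ord_recr -addrA lerDl addr_ge0.
have := archi_boundP (ltW (lt_le_trans ltr01 (_ : 1 <= S))).
rewrite lerDl sumr_ge0 // => /(_ isT) lt.
exists (Num.bound S); apply: le_trans S_le _.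
by rewrite -(ratr_nat C) ler_rat ltW.
Qed.

(** If [|x| > 1], then [t = |x|^2 - 1] is not infinitesimal, since its inverse is algebraic and so
    bounded; by Bernoulli's inequality some power of [|x|] then exceeds [b]. *)
Lemma norm_le1_of_bounded_powers x (b : nat) : algQ x ->
  (forall n, (0 < n)%N -> `|x| ^+ n <= b%:R) -> `|x| <= 1.
Proof.
move=> ax H.
have /orP[//|ge1] := real_comparable (normr_real x) (real1 C).
move: ge1; rewrite le_eqVlt => /predU1P[<- //|gt1].
pose t := x * x^* - 1.
have tE : t = `|x| ^+ 2 - 1 by rewrite normCK.
have t0 : 0 < t by rewrite tE subr_gt0 exprn_egt1 ?gt1.
have at' : algQ t^-1.
  apply: integral_inv; apply: integral_sub; last exact: (algQ_nat 1).
  by apply: integral_mul => //; apply: algQ_conj.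
have [n] := algQ_bounded at'; rewrite ger0_norm ?invr_ge0 ?(ltW t0) // => tn.
have n0 : 0 < (n%:R : C) by apply: lt_le_trans tn; rewrite invr_gt0.
have bern k : 1 + k%:R * t <= `|x| ^+ (2 * k).
  elim: k => [|k IH]; first by rewrite mul0r addr0 muln0 expr0.
  have -> : (2 * k.+1 = 2 + 2 * k)%N by lia.
  rewrite exprD (_ : `|x| ^+ 2 = 1 + t); last by rewrite tE addrC subrK.
  apply: (@le_trans _ _ ((1 + t) * (1 + k%:R * t))).
    rewrite -natr1 -subr_ge0.
    have -> : (1 + t) * (1 + k%:R * t) - (1 + (k%:R + 1) * t) = k%:R * t ^+ 2 by ring.
    by rewrite mulr_ge0 // exprn_ge0 // ltW.
  by apply: ler_wpM2l => //; rewrite addr_ge0 // ltW.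
have tn' : 1 <= t * n%:R by rewrite -ler_pdivrMl // mulr1.
have n0' : (0 < n)%N by rewrite ltr0n in n0.
(* As [t n >= 1], Bernoulli's lower bound at [n (b + 1)] is at least [1 + (b + 1)]. *)
have := le_trans (bern (n * b.+1)%N) (H _ _); rewrite muln_gt0 /= muln_gt0 n0' => /(_ isT).
rewrite natrM mulrAC mulrC (mulrC n%:R).
have le2 : (b.+1%:R : C) <= b.+1%:R * (t * n%:R) by rewrite ler_peMr.
move=> le3; have := le_trans (_ : 1 + b.+1%:R <= _) le3.
by rewrite lerD2l le2 => /(_ isT); rewrite addrC natr1 ler_nat; lia.
Qed.

(** A fixed linear combination of shifted power sums isolates the powers of a single [u]; its
    constants are algebraic, hence bounded by naturals, so these powers are bounded too. *)
Lemma norm_le1_of_bounded_psums (us : seq C) (b : nat) :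
  (forall u, u \in us -> algQ u) ->
  (forall n, (0 < n)%N -> `|psum us n| <= b%:R) ->
  forall u, u \in us -> `|u| <= 1.
Proof.
move=> aus H u uus.
(* [Q] kills all the values occurring in [us] but [u]. *)
pose vs := [seq v <- undup us | v != u].
pose Q : {poly C} := \prod_(v <- vs) ('X - v%:P).
have avs v : v \in vs -> algQ v by rewrite mem_filter mem_undup => /andP[_ /aus].
have aQ i : algQ Q`_i.
  rewrite /Q; elim: (vs) avs i => [|v s IH] avs i.
    rewrite big_nil coef1; exact: (algQ_nat (i == 0)%N).
  have {}IH j := IH (fun w ws => avs w (mem_behead (s := v :: s) ws)) j.
  rewrite big_cons mulrBl coefB coefXM coefCM; apply: integral_sub.
    by case: i => [|i] /=; [exact: (algQ_nat 0)|exact: IH].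
  exact: integral_mul (avs v (mem_head v s)) (IH i).
have Qu0 : Q.[u] != 0.
  by rewrite -[_ == 0]/(root Q u) root_prod_XsubC mem_filter eqxx.
have Q0 v : v \in us -> v != u -> Q.[v] = 0.
  by move=> vus vu; apply/rootP; rewrite root_prod_XsubC mem_filter vu mem_undup.
pose m := count_mem u us.
have m0 : (0 < m)%N by rewrite -has_count has_pred1.
have key n : m%:R * Q.[u] * u ^+ n = \sum_(i < size Q) Q`_i * psum us (n + i).
  under eq_bigr => i _ do rewrite /psum big_distrr /=.
  rewrite exchange_big /=.
  transitivity (\sum_(v <- us) v ^+ n * Q.[v]).
    rewrite (bigID (pred1 u)) /= [X in _ = _ + X]big_seq_cond.
    rewrite [X in _ = _ + X]big1 ?addr0 => [|v /andP[vus vu]]; last by rewrite Q0 ?mulr0.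
    rewrite (eq_bigr (fun=> u ^+ n * Q.[u])) => [|v /eqP -> //].
    by rewrite big_const_seq iter_addr_0 -mulr_natl -[count _ _]/m; ring.
  apply: eq_bigr => v _; rewrite horner_coef big_distrr /=.
  by apply: eq_bigr => i _; rewrite exprD; ring.
have aD : algQ (m%:R * Q.[u])^-1.
  apply: integral_inv; apply: integral_mul; first exact: algQ_nat.
  rewrite horner_coef; apply: algQ_sum => i _; apply: integral_mul (aQ i) _.
  by elim: {i}(i : nat) => [|k IH]; [exact: (algQ_nat 1)|rewrite exprS; apply: integral_mul (aus _ uus) IH].
have [c cP] := algQ_bounded aD.
have [c' c'P] : exists c' : nat, \sum_(i < size Q) `|Q`_i| <= c'%:R.
  elim: (size Q) => [|k [c' IH]]; first by exists 0%N; rewrite big_ord0.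
  have [c'' H''] := algQ_bounded (aQ k); exists (c' + c'')%N.
  by rewrite big_ord_recr natrD lerD.
apply: (@norm_le1_of_bounded_powers _ (c * (c' * b))%N); first exact: aus.
move=> n n0.
have D0 : m%:R * Q.[u] != 0 by rewrite mulf_neq0 // pnatr_eq0 -lt0n.
rewrite -normrX -[u ^+ n](mulKf D0) key normrM natrM ler_pM //.
apply: le_trans (ler_norm_sum _ _ _) _.
rewrite natrM; apply: (@le_trans _ _ (\sum_(i < size Q) `|Q`_i| * b%:R)).
  by apply: ler_sum => i _; rewrite normrM ler_wpM2l // H // addn_gt0 n0.
by rewrite -mulr_suml ler_wpM2r.
Qed.

End Archimedean.

(** * Stepanov's method *)

Section Stepanov.
Variable K : closedFieldType.

Lemma poly_lin_dep (J : finType) (D : nat) (P : J -> {poly K}) :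
  (forall j, size (P j) <= D)%N -> (D < #|J|)%N ->
  exists2 c : J -> K, exists j, c j != 0 & \sum_j c j *: P j = 0.
Proof.
move=> sP ltDJ.
pose A := \matrix_(i < #|J|, k < D) (P (enum_val i))`_k.
have /rowV0Pn[v /sub_kermxP vA /rV0Pn[i vi]] : kermx A != 0.
  rewrite -mxrank_eq0 mxrank_ker subn_eq0 -ltnNge.
  exact: leq_ltn_trans (rank_leq_col A) ltDJ.
exists (fun j => v 0 (enum_rank j)); first by exists (enum_val i); rewrite enum_valK.
apply/polyP => k; rewrite coef0 coef_sum.
under eq_bigr => j _ do rewrite coefZ.
have [ltkD|leDk] := ltnP k D; last first.
  by rewrite big1 // => j _; rewrite nth_default ?mulr0 // (leq_trans (sP j)).
have /matrixP/(_ 0 (Ordinal ltkD)) := vA; rewrite !mxE => vAk; rewrite -[RHS]vAk.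
rewrite (reindex (@enum_val J J)) /=; last exact: onW_bij (enum_val_bij J).
by apply: eq_bigr => l _; rewrite mxE enum_valK.
Qed.

(** The term of largest degree cannot cancel. *)
Lemma sum_distinct_size (J : finType) (P : J -> {poly K}) j0 :
  P j0 != 0 ->
  (forall j j', P j != 0 -> P j' != 0 -> size (P j) = size (P j') -> j = j') ->
  \sum_j P j != 0.
Proof.
move=> Pj0 inj; case: (@arg_maxnP J j0 xpredT (fun j => size (P j))) => // m _ mP.
have Pm : P m != 0 by rewrite -size_poly_gt0 (leq_trans _ (mP j0 isT)) // size_poly_gt0.
apply/eqP => /(congr1 (fun Q : {poly K} => Q`_(size (P m)).-1)).
rewrite coef0 coef_sum (bigD1 m) //= big1 ?addr0 => [/eqP|j jm].
  by rewrite -lead_coefE lead_coef_eq0 (negPf Pm).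
have [->|Pj] := eqVneq (P j) 0; first exact: coef0.
apply: nth_default; rewrite -ltnS prednK ?size_poly_gt0 // ltn_neqAle.
by rewrite [(_ <= _)%N]mP // andbT; apply: contra jm => /eqP /inj ->.
Qed.

Lemma closed_root_exists n (x : K) : (0 < n)%N -> exists y, y ^+ n = x.
Proof.
move=> n0; have : size ('X^n - x%:P) != 1%N by rewrite size_XnsubC // eqSS -lt0n.
by case/closed_rootP => y; rewrite rootE !hornerE subr_eq0 => /eqP; exists y.
Qed.

Variables (p : nat) (pK : p \in [pchar K]).

Lemma sum_exp_pchar (I : Type) (s : seq I) (F : I -> K) n :
  (\sum_(i <- s) F i) ^+ (p ^ n) = \sum_(i <- s) F i ^+ (p ^ n).
Proof.
have pp := pcharf_prime pK.
elim: s => [|i s IH]; first by rewrite !big_nil expr0n expn_eq0 -leqn0 leqNgt prime_gt0.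
by rewrite !big_cons (exprDn_pchar _ _ _) ?IH // pnatX pnatE // pK.
Qed.

(* Bombieri's form of Stepanov's method, free of derivatives.  With [e = p ^ a],
   [r = p e] and [T] the half trace, [T ^ r = b - T] and [x ^ (r r) = x] on [Z].
   So [h = \sum k_j x^(u + r i) T^v] satisfies [h ^ r = \sum c_j Q_j] on [Z], with
   [c_j = k_j ^ r]; there are more unknowns than coefficients, and [h] is nonzero
   because its terms have pairwise distinct degrees. *)
Lemma stepanov (f : {poly K}) d a (b : K) (Z : seq K) :
  size f = d.+1 -> ~~ (p %| d)%N -> uniq Z ->
  {in Z, forall x, x ^+ (p ^ a.+1 * p ^ a.+1) = x} ->
  {in Z, forall x, \sum_(i < a.+1 + a.+1) f.[x] ^+ (p ^ i) = b} ->
  (size Z <= p ^ a * p ^ a.+1 + (2 * d + 1) * p ^ a.+1)%N.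
Proof.
move=> sf pd uZ ZF ZT; set e := (p ^ a)%N; set r := (p ^ a.+1)%N.
have pp := pcharf_prime pK; have p0 := prime_gt0 pp; have p1 := prime_gt1 pp.
have rE : r = (p * e)%N by rewrite /r expnS.
have e0 : (0 < e)%N by rewrite expn_gt0 p0.
have d0 : (0 < d)%N by case: (d) pd => //; rewrite dvdn0.
have f0 : f != 0 by rewrite -size_poly_gt0 sf.
pose T : {poly K} := \sum_(t < a.+1) f ^+ (p ^ t).
have sfX n : size (f ^+ n) = (d * n).+1.
  have := size_exp f n; rewrite sf /= => <-; rewrite prednK //.
  by rewrite size_poly_gt0 expf_neq0.
have sT : size T = (d * e).+1.
  rewrite /T big_ord_recr /= addrC size_polyDl sfX // ltnS.
  apply: leq_trans (size_sum _ _ _) _; apply/bigmax_leqP => i _.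
  by rewrite sfX ltn_pmul2l // ltn_exp2l.
have T0 : T != 0 by rewrite -size_poly_gt0 sT.
have sTX n : size (T ^+ n) = (d * e * n).+1.
  have := size_exp T n; rewrite sT /= => <-; rewrite prednK //.
  by rewrite size_poly_gt0 expf_neq0.
(* With [u < e], [i < m], [v < p] there are [e m p = e r + d r] unknowns, which exceeds the size
   bound [D] below by [r - e - d + d e > 0]. *)
pose m := (e + d)%N.
pose J := ('I_e * 'I_m * 'I_p)%type.
(* On [Z] this is the [r]-th power of [x ^ (u + r i) T ^ v], reduced by [x ^ (r r) = x] and
   [T ^ r = b - T]. *)
pose Q (j : J) : {poly K} := 'X^(j.1.1 * r + j.1.2) * (b%:P - T) ^+ j.2.
pose D := ((e - 1) * r + m + p.-1 * d * e)%N.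
have sQ j : (size (Q j) <= D)%N.
  case: j => [[k i] j]; rewrite /Q /=.
  apply: leq_trans (size_polyMleq _ _) _; rewrite size_polyXn addSn /=.
  have : (size ((b%:P - T) ^+ j) <= (d * e * j).+1)%N.
    apply: leq_trans (size_poly_exp_leq _ _) _; rewrite ltnS leq_mul // -subn1 leq_subLR add1n.
    rewrite (leq_trans (size_polyD _ _)) // geq_max size_polyN sT leqnn andbT.
    by rewrite (leq_trans (size_polyC_leq1 _)).
  move=> sj; apply: leq_trans (leq_add (leqnn _) sj) _.
  rewrite addnS -addSn /D leq_add //.
    rewrite -addnS leq_add // leq_mul2r; have := ltn_ord k; lia.
  by rewrite mulnC -mulnA leq_mul2r; have := ltn_ord j; lia.
have [|c [j0 cj0] Qc] := poly_lin_dep sQ.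
  rewrite !card_prod !card_ord /D /m.
  have h1 : (e * (e + d) * p = e * r + d * r)%N by rewrite rE; ring.
  have h2 : ((e - 1) * r = e * r - r)%N by rewrite mulnBl mul1n.
  have h3 : (p.-1 * d * e = d * r - d * e)%N by rewrite rE -subn1 -mulnA mulnBl mul1n mulnCA.
  have h4 : (2 * e <= r)%N by rewrite rE leq_mul2r p1 orbT.
  have h5 : (r <= e * r)%N by rewrite leq_pmull.
  have h6 : (d <= d * e)%N by rewrite leq_pmulr.
  have h7 : (d * e <= d * r)%N by rewrite leq_mul2l; apply/orP; right; lia.
  lia.
have [k kP] : exists k : J -> K, forall j, k j ^+ r = c j.
  have r0 : (0 < r)%N by rewrite expn_gt0 p0.
  have exk j : exists y, y ^+ r == c j by have [y <-] := closed_root_exists (c j) r0; exists y.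
  by exists (fun j => xchoose (exk j)) => j; apply/eqP/(xchooseP (exk j)).
have k0 j : (k j == 0) = (c j == 0) by rewrite -kP expf_eq0 expn_gt0 p0.
pose H j := k j *: ('X^(j.1.1 + r * j.1.2) * T ^+ j.2).
have sH j : k j != 0 -> size (H j) = (j.1.1 + r * j.1.2 + d * e * j.2).+1.
  move=> kj; rewrite size_scale // size_monicM ?monicXn ?expf_neq0 //.
  by rewrite size_polyXn sTX addSn addnS.
pose h := \sum_j H j.
have h0 : h != 0.
  have kH j : (H j != 0) = (k j != 0).
    by rewrite scaler_eq0 mulf_eq0 !expf_eq0 polyX_eq0 (negPf T0) !andbF !orbF.
  apply: (@sum_distinct_size _ _ j0); rewrite ?kH ?k0 // => j j'; rewrite !kH => kj kj'.
  rewrite !sH // => -[]; case: j j' {kj kj'} => [[u i] v] [[u' i'] v'] /=.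
  rewrite rE => E.
  (* The degree determines [u] modulo [e], then [v] modulo [p] because [p] does not divide [d], and
     finally [i]. *)
  have E1 : (u + e * (p * i + d * v) = u' + e * (p * i' + d * v'))%N by lia.
  have uu : u = u' :> nat.
    have := congr1 (modn^~ e) E1.
    by rewrite !(addnC (nat_of_ord _)) !(mulnC e) !modnMDl !modn_small.
  have E2 : (p * i + d * v = p * i' + d * v')%N.
    by apply/eqP; rewrite -(eqn_pmul2l e0) -(eqn_add2l u) {2}uu E1.
  have vv : v = v' :> nat.
    have := congr1 (modn^~ p) E2; rewrite !(mulnC p) !modnMDl => E3.
    wlog le : v v' {E E1 E2} E3 / (v <= v')%N.
      by move=> W; case/orP: (leq_total v v') => ?; [apply: W|symmetry; apply: W].
    have := eqn_mod_dvd p (leq_mul (leqnn d) le); rewrite E3 eqxx -mulnBr.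
    rewrite Euclid_dvdM // (negPf pd) /= => /esym /dvdn_leq.
    by have := ltn_ord v'; case: (ltngtP v v') le => // ? _; lia.
  have ii : i = i' :> nat by nia.
  by congr (_, _, _); apply: val_inj.
have hZ : all (root h) Z.
  apply/allP => x xZ; rewrite rootE.
  have : h.[x] ^+ r = 0.
    rewrite /h horner_sum sum_exp_pchar -/r.
    transitivity ((\sum_j c j *: Q j).[x]); last by rewrite Qc horner0.
    rewrite horner_sum; apply: eq_bigr => j _.
    rewrite /H /Q !hornerE /=.
    rewrite !exprMn kP; congr (_ * _ * _).
      rewrite -exprM.
      have -> : ((j.1.1 + r * j.1.2) * r = j.1.1 * r + r * r * j.1.2)%N by ring.
      by rewrite exprD (exprM x (r * r)%N) ZF // exprD.
    rewrite -exprM mulnC exprM; congr (_ ^+ _).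
    have -> : T.[x] = \sum_(i < a.+1) f.[x] ^+ (p ^ i).
      by rewrite horner_sum; apply: eq_bigr => i _; rewrite horner_exp.
    (* The second half of the trace [b] is the [r]-th power of the first half [T]. *)
    rewrite -(ZT x xZ) sum_exp_pchar big_split_ord /= addrAC subrr add0r.
    by apply: eq_bigr => i _; rewrite -exprM -expnD addnC.
  by move/eqP; rewrite expf_eq0 => /andP[].
have := max_poly_roots h0 hZ uZ.
have : (size h <= (e - 1) + r * (m - 1) + d * e * (p - 1) + 1)%N.
  apply: leq_trans (size_sum _ _ _) _; apply/bigmax_leqP => j _.
  have [kj|kj] := eqVneq (k j) 0; first by rewrite /H kj scale0r size_poly0.
  rewrite sH // -addn1 leq_add2r.
  have le_pred n (i : 'I_n) : (i <= n - 1)%N by rewrite -ltnS subn1 (ltn_predK (ltn_ord i)).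
  by rewrite leq_add ?leq_add ?leq_mul.
have h1 : (r * (m - 1) <= e * r + d * r)%N by rewrite mulnC -mulnDl leq_mul2r leq_subr orbT.
have h2 : (d * e * (p - 1) <= d * r)%N.
  by rewrite -mulnA leq_mul2l rE (mulnC p) leq_mul2l leq_subr !orbT.
have h3 : (e <= r)%N by rewrite rE leq_pmull.
have h4 : ((2 * d + 1) * r = d * r + d * r + r)%N by ring.
move=> s1 s2; have := leq_trans s2 s1; rewrite addn1 ltnS h4 => s3.
apply: leq_trans s3 (leq_trans (leq_add (leq_add (leq_trans (leq_subr 1 e) h3) h1) h2) _).
by apply: eq_leq; ring.
Qed.

End Stepanov.

(** * The L-function of an additive character sum *)

Section LFunction.
Variables (p : nat) (K : closedFieldType) (pK : p \in [pchar K]).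
Variable emb : {rmorphism 'F_p -> K}.

Let pp : prime p := pcharf_prime pK.
Let p0 : (0 < p)%N := prime_gt0 pp.
Notation frob := (pFrobenius_aut pK).

Definition roots_of (g : {poly K}) : seq K := sval (closed_field_poly_normal g).

Lemma roots_ofE g : g \is monic -> \prod_(z <- roots_of g) ('X - z%:P) = g.
Proof.
rewrite /roots_of; case: closed_field_poly_normal => r /= E /monicP g1.
by rewrite [RHS]E g1 scale1r.
Qed.

Lemma mem_roots_of g x : g \is monic -> (x \in roots_of g) = root g x.
Proof. by move=> gm; rewrite -[g in RHS]roots_ofE // root_prod_XsubC. Qed.

Lemma size_roots_of g : g \is monic -> size g = (size (roots_of g)).+1.
Proof. by move=> gm; rewrite -{1}(roots_ofE gm) size_prod_XsubC. Qed.

Lemma perm_roots_of s : perm_eq (roots_of (\prod_(z <- s) ('X - z%:P))) s.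
Proof. by apply: prod_XsubC_eq; rewrite roots_ofE // monic_prod_XsubC. Qed.

Lemma perm_roots_ofM g h : g \is monic -> h \is monic ->
  perm_eq (roots_of (g * h)) (roots_of g ++ roots_of h).
Proof.
move=> gm hm; apply: prod_XsubC_eq.
by rewrite big_cat /= !roots_ofE ?monicMl.
Qed.

Lemma frob_iter_inj n : injective (fun x : K => x ^+ (p ^ n)).
Proof.
elim: n => [|n IH] x y; first by rewrite !expr1.
rewrite expnSr !exprM => E; apply: IH; exact: (fmorph_inj frob).
Qed.

Lemma expFp (a : 'F_p) : a ^+ p = a.
Proof. by rewrite -[RHS]expf_card card_Fp. Qed.

(** [X^p - X] has at most [p] roots, and the image of the prime field already supplies [p]. *)
Lemma frob_fixedP x : x ^+ p = x -> exists a, x = emb a.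
Proof.
move=> xp; have [/codomP //|nx] := boolP (x \in codom emb).
pose P : {poly K} := 'X^p - 'X.
have sP : size P = p.+1.
  by rewrite size_polyDl ?size_polyXn // size_polyN size_polyX ltnS prime_gt1.
have P0 : P != 0 by rewrite -size_poly_gt0 sP.
have rP : all (root P) (x :: codom emb).
  rewrite /= rootE !hornerE xp subrr eqxx /=; apply/allP => _ /codomP [a ->].
  by rewrite rootE !hornerE -rmorphXn /= expFp subrr.
have uP : uniq (x :: codom emb).
  by rewrite /= nx map_inj_uniq ?enum_uniq //; apply: fmorph_inj.
by have := max_poly_roots P0 rP uP; rewrite sP /= size_codom card_Fp // ltnn.
Qed.

(* inverse of [emb], with junk value [0] off the prime field *)
Definition descend (x : K) : 'F_p := odflt 0 [pick a | emb a == x].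

Lemma descend_emb a : descend (emb a) = a.
Proof.
rewrite /descend; case: pickP => [b /eqP /fmorph_inj //|/(_ a)].
by rewrite eqxx.
Qed.

Lemma descendK x : x ^+ p = x -> emb (descend x) = x.
Proof. by case/frob_fixedP => a ->; rewrite descend_emb. Qed.

Lemma descendD x y : x ^+ p = x -> y ^+ p = y ->
  descend (x + y) = descend x + descend y.
Proof.
by case/frob_fixedP => a -> /frob_fixedP[b ->]; rewrite -rmorphD !descend_emb.
Qed.

Lemma map_frob_emb (g : {poly 'F_p}) : map_poly frob (map_poly emb g) = map_poly emb g.
Proof.
rewrite -map_poly_comp; apply: eq_map_poly => a /=.
by rewrite pFrobenius_autE -rmorphXn /= expFp.
Qed.

Lemma descend_poly (g : {poly K}) : map_poly frob g = g ->
  exists h, g = map_poly emb h.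
Proof.
move=> gF; exists (map_poly descend g); apply/polyP => i.
have := congr1 (fun q : {poly K} => q`_i) gF; rewrite coef_map => gi.
rewrite coef_map coef_map_id0 /= ?(descendK gi) //.
by rewrite -(rmorph0 emb) descend_emb.
Qed.

Lemma map_frob_prod (s : seq K) :
  map_poly frob (\prod_(z <- s) ('X - z%:P)) = \prod_(z <- map (fun x => x ^+ p) s) ('X - z%:P).
Proof.
rewrite rmorph_prod big_map; apply: eq_bigr => z _.
by rewrite rmorphB /= map_polyX map_polyC.
Qed.

Lemma perm_frob_roots (g : {poly K}) : g \is monic -> map_poly frob g = g ->
  perm_eq (map (fun x => x ^+ p) (roots_of g)) (roots_of g).
Proof.
by move=> gm gF; apply: prod_XsubC_eq; rewrite -map_frob_prod !roots_ofE.
Qed.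

Lemma expp_gt1 n : (0 < n)%N -> (1 < p ^ n)%N.
Proof.
move=> n0; apply: leq_trans (prime_gt1 pp) _.
by rewrite -[X in (X <= _)%N]expn1 leq_exp2l ?prime_gt1.
Qed.

(** For [n > 0], the subfield of [K] with [p ^ n] elements. *)
Definition fixed_points n : seq K := roots_of ('X^(p ^ n) - 'X).

Lemma fixed_points_monic n : (0 < n)%N ->
  ('X^(p ^ n) - 'X : {poly K}) \is monic.
Proof.
move=> n0; rewrite monicE lead_coefDl ?lead_coefXn //.
by rewrite size_polyN size_polyX size_polyXn ltnS expp_gt1.
Qed.

Lemma mem_fixed_points n x : (0 < n)%N ->
  (x \in fixed_points n) = (x ^+ (p ^ n) == x).
Proof.
by move=> n0; rewrite mem_roots_of ?fixed_points_monic // rootE !hornerE subr_eq0.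
Qed.

Lemma size_fixed_points n : (0 < n)%N -> size (fixed_points n) = (p ^ n)%N.
Proof.
move=> n0; apply: succn_inj; rewrite -size_roots_of ?fixed_points_monic //.
rewrite size_polyDl ?size_polyXn //.
by rewrite size_polyN size_polyX ltnS expp_gt1.
Qed.

(** The derivative of [X^(p ^ n) - X] is [-1], so this polynomial is separable. *)
Lemma uniq_fixed_points n : (0 < n)%N -> uniq (fixed_points n).
Proof.
move=> n0; rewrite -separable_prod_XsubC roots_ofE ?fixed_points_monic //.
rewrite unlock derivB derivXn derivX -mulr_natl natrX.
have -> : (p%:R : {poly K}) = 0 by rewrite -polyC_natr (pcharf0 pK).
rewrite expr0n eqn0Ngt n0 /= mul0r sub0r.
by rewrite -(scaleN1r (1 : {poly K})) coprimepZr ?oppr_eq0 ?oner_eq0 // coprimep1.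
Qed.

Definition orbit_seq n (x : K) : seq K := [seq x ^+ (p ^ i) | i <- index_iota 0 n].
(** For [x] in the field with [p ^ n] elements, the characteristic polynomial of [x] over the prime
    field, that is, a power of its minimal polynomial. *)
Definition orbit_poly n x : {poly K} := \prod_(z <- orbit_seq n x) ('X - z%:P).

Lemma orbit_poly_monic n x : orbit_poly n x \is monic.
Proof. exact: monic_prod_XsubC. Qed.

Lemma size_orbit_poly n x : size (orbit_poly n x) = n.+1.
Proof. by rewrite size_prod_XsubC size_map size_iota subn0. Qed.

Lemma orbit_polyD e n x : x ^+ (p ^ e) = x ->
  orbit_poly (e + n) x = orbit_poly e x * orbit_poly n x.
Proof.
move=> xe; rewrite /orbit_poly /orbit_seq !big_map.
rewrite (big_cat_nat (n := e)) ?leq_addr //=; congr (_ * _).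
rewrite -{1}(add0n e) big_addn addKn; apply: eq_bigr => i _.
by rewrite addnC expnD exprM xe.
Qed.

Lemma map_frob_orbit_poly n x : x ^+ (p ^ n) = x ->
  map_poly frob (orbit_poly n x) = orbit_poly n x.
Proof.
case: n => [|n] xn; first by rewrite /orbit_poly /= big_nil rmorph1.
rewrite map_frob_prod /orbit_poly /orbit_seq -map_comp !big_map.
rewrite big_nat_recr //= [in RHS]big_nat_recl //= mulrC.
rewrite -exprM -expnSr xn expr1; congr (_ * _).
by apply: eq_bigr => i _; rewrite -exprM -expnSr.
Qed.

Lemma root_orbit_poly n x : (0 < n)%N -> root (orbit_poly n x) x.
Proof.
move=> n0; rewrite root_prod_XsubC; apply/mapP; exists 0%N; rewrite ?expr1 //.
by rewrite mem_index_iota.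
Qed.

(* Each root [x] of a Frobenius-invariant polynomial [g], of Frobenius order
   [e], contributes exactly the lengths [e, 2 e, ..., m e], where [m] is the
   multiplicity of [x] in [g]. *)
Lemma count_orbit_dvd n (g : {poly K}) x :
  g \is monic -> size g = n.+1 -> map_poly frob g = g ->
  (\sum_(0 <= j < n) ((x ^+ (p ^ j.+1) == x)%R && (orbit_poly j.+1 x %| g)%R))%N
  = count_mem x (roots_of g).
Proof.
elim/ltn_ind: n g => n IHn g gm sg gF.
have [xg|xg] := boolP (x \in roots_of g); last first.
  rewrite (count_memPn xg) big1 // => j _; apply/eqP; rewrite eqb0 negb_and.
  apply/orP; right; apply: contra xg => /dvdpP[h E].
  by rewrite mem_roots_of // E rootM root_orbit_poly ?orbT.
have iter_root i : x ^+ (p ^ i) \in roots_of g.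
  elim: i => [|i IH]; first by rewrite expr1.
  rewrite expnSr exprM -(perm_mem (perm_frob_roots gm gF)).
  by apply/mapP; exists (x ^+ (p ^ i)).
have dist i j : (i < j)%N -> x ^+ (p ^ i) = x ^+ (p ^ j) -> x ^+ (p ^ (j - i)) = x.
  move=> ij E; apply: (@frob_iter_inj i).
  by rewrite -exprM -expnD subnK // ltnW.
(* The [n + 1] iterates [x ^ (p ^ i)] with [i <= n] all lie among the [n] roots of [g], so two of
   them coincide. *)
have : exists e, (0 < e)%N && (x ^+ (p ^ e) == x).
  have : ~~ uniq (orbit_seq n.+1 x).
    apply: contraL (leqnn n.+1) => u; rewrite -leqNgt.
    have := uniq_leq_size u (_ : {subset _ <= roots_of g}).
    rewrite size_map size_iota subn0 => H.
    have : (n < size (roots_of g))%N by apply: H => _ /mapP[i _ ->].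
    by move: sg; rewrite size_roots_of // => -[->]; rewrite ltnn.
  case/(uniqPn 0) => i [j] []; rewrite size_map size_iota subn0 => ij jn.
  rewrite !(nth_map 0%N) ?size_iota ?subn0 ?(ltn_trans ij) //.
  rewrite !nth_iota ?subn0 ?(ltn_trans ij) // !add0n => /(dist _ _ ij) E.
  by exists (j - i)%N; rewrite subn_gt0 ij E /=.
case/ex_minnP => e /andP[e0 /eqP xe] e_min.
have u_orb : uniq (orbit_seq e x).
  apply/(uniqPn 0) => -[i [j] []]; rewrite size_map size_iota subn0 => ij jn.
  rewrite !(nth_map 0%N) ?size_iota ?subn0 ?(ltn_trans ij) //.
  rewrite !nth_iota ?subn0 ?(ltn_trans ij) // !add0n => /(dist _ _ ij) E.
  have := e_min (j - i)%N; rewrite subn_gt0 ij E eqxx => /(_ isT).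
  by rewrite leqNgt (leq_ltn_trans (leq_subr _ _) jn).
have Pg : orbit_poly e x %| g.
  apply: uniq_roots_dvdp; last by rewrite uniq_rootsE.
  by apply/allP => _ /mapP[i _ ->]; rewrite -mem_roots_of.
(* Divide out one copy of the minimal polynomial of [x]: lengths up to [e] contribute exactly [1],
   and length [e + i] for [g] corresponds to length [i] for [h], where induction applies. *)
have [h gE] : exists h, g = orbit_poly e x * h.
  by case/dvdpP: Pg => h ->; exists h; rewrite mulrC.
have Pm := orbit_poly_monic e x.
have P0 := monic_neq0 Pm.
have hm : h \is monic by rewrite -(monicMl _ Pm) -gE.
have hF : map_poly frob h = h.
  apply: (mulfI P0); rewrite -[in RHS]gE -gF gE rmorphM /=.
  by rewrite map_frob_orbit_poly.
have [m nE] : exists m, n = (e + m)%N.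
  exists (n - e)%N; rewrite subnKC //.
  by have := dvdp_leq (monic_neq0 gm) Pg; rewrite size_orbit_poly sg ltnS.
have sh : size h = m.+1.
  move: sg; rewrite gE size_monicM ?monic_neq0 // size_orbit_poly nE.
  by rewrite addSn /= => E; apply/eqP; rewrite -(eqn_add2l e) E addnS.
rewrite nE (big_cat_nat (n := e)) ?leq_addr //=.
have -> : (\sum_(0 <= i < e) ((x ^+ (p ^ i.+1) == x)%R && (orbit_poly i.+1 x %| g)%R) = 1)%N.
  rewrite -(prednK e0) big_nat_recr //= prednK // xe eqxx Pg big_nat big1 // => i /andP[_ ie].
  case: eqP => // E; have := e_min i.+1; rewrite E eqxx => /(_ isT).
  by rewrite leqNgt -(ltn_predK e0) ltnS ie.
have -> : (\sum_(e <= i < e + m) ((x ^+ (p ^ i.+1) == x)%R && (orbit_poly i.+1 x %| g)%R))%N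
  = count_mem x (roots_of h).
  rewrite -{1}(add0n e) big_addn addKn -(IHn m) //; last by rewrite nE -[X in (X < _)%N]add0n ltn_add2r.
  apply: eq_bigr => i _; rewrite -addSn addnC expnD exprM xe orbit_polyD //.
  by rewrite gE dvdp_mul2l.
rewrite gE (permP (perm_roots_ofM Pm hm)) count_cat; congr (_ + _)%N.
rewrite (permP (perm_roots_of _)) count_uniq_mem //.
by rewrite -root_prod_XsubC root_orbit_poly.
Qed.

(** The polynomial analogue of [\sum_(d | n) Lambda(d) = log n], obtained by adding up the
    multiplicities of all roots of [g]. *)
Lemma sum_orbit_dvd n (g : {poly K}) :
  g \is monic -> size g = n.+1 -> map_poly frob g = g ->
  (\sum_(0 <= j < n) \sum_(x <- fixed_points j.+1) (orbit_poly j.+1 x %| g)%R)%N = n.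
Proof.
move=> gm sg gF.
transitivity (size (roots_of g)); last by apply: succn_inj; rewrite -size_roots_of.
rewrite -sum1_size -[RHS]big_undup_iterop_count.
transitivity (\sum_(0 <= j < n) \sum_(x <- undup (roots_of g))
   ((x ^+ (p ^ j.+1) == x)%R && (orbit_poly j.+1 x %| g)%R))%N; last first.
  rewrite exchange_big /=; apply: eq_bigr => x _.
  by rewrite count_orbit_dvd // Monoid.iteropE iter_addn_0 mul1n.
have sum_size (s : seq K) (P : pred K) : (\sum_(x <- s) P x)%N = size (filter P s).
  by elim: s => [|x s IH]; rewrite ?big_nil // big_cons IH /=; case: (P x).
apply: eq_bigr => j _; rewrite !sum_size; apply/perm_size/uniq_perm.
- by rewrite filter_uniq ?uniq_fixed_points.
- by rewrite filter_uniq ?undup_uniq.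
move=> x; rewrite !mem_filter mem_fixed_points // mem_undup mem_roots_of //.
have [/dvdpP[h ->]|] := boolP (orbit_poly j.+1 x %| g); last by rewrite andbF.
by rewrite rootM root_orbit_poly // orbT !andbT.
Qed.

Variables (C : idomainType) (psi : 'F_p -> C) (f : {poly 'F_p}) (d : nat).
Hypotheses (psi0 : psi 0 = 1) (psiD : forall a b, psi (a + b) = psi a * psi b).

Definition monic_of n (a : {ffun 'I_n -> 'F_p}) : {poly 'F_p} :=
  'X^n + \sum_(i < n) a i *: 'X^i.
Definition coefs_of n (g : {poly 'F_p}) : {ffun 'I_n -> 'F_p} := [ffun i => g`_(val i)].

Lemma coef_monic_of n (a : {ffun 'I_n -> 'F_p}) (i : 'I_n) : (monic_of a)`_i = a i.
Proof.
rewrite coefD coefXn ltn_eqF // add0r coef_sum (bigD1 i) //= big1 => [|j ji].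
  by rewrite coefZ coefXn eqxx mulr1 addr0.
by rewrite coefZ coefXn eq_sym (negPf (_ : _ != _)) ?mulr0.
Qed.

Lemma size_monic_of_tail n (a : {ffun 'I_n -> 'F_p}) :
  (size (\sum_(i < n) a i *: 'X^i : {poly 'F_p})%R <= n)%N.
Proof.
apply: leq_trans (size_sum _ _ _) _; apply/bigmax_leqP => i _.
by apply: leq_trans (size_scale_leq _ _) _; rewrite size_polyXn.
Qed.

Lemma size_monic_of n (a : {ffun 'I_n -> 'F_p}) : size (monic_of a) = n.+1.
Proof. by rewrite size_polyDl size_polyXn // ltnS size_monic_of_tail. Qed.

Lemma monic_of_monic n (a : {ffun 'I_n -> 'F_p}) : monic_of a \is monic.
Proof. by rewrite monicE lead_coefDl ?lead_coefXn // size_polyXn ltnS size_monic_of_tail. Qed.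

Lemma monic_ofK n : cancel (@monic_of n) (@coefs_of n).
Proof. by move=> a; apply/ffunP => i; rewrite ffunE coef_monic_of. Qed.

Lemma coefs_ofK n g : g \is monic -> size g = n.+1 -> monic_of (coefs_of n g) = g.
Proof.
move=> gm sg; apply/polyP => i; have [lt_in|] := ltnP i n.
  by rewrite (coef_monic_of _ (Ordinal lt_in)) ffunE.
rewrite leq_eqVlt => /predU1P[<-|lt_ni]; last by rewrite !nth_default ?size_monic_of ?sg.
have := monic_of_monic (coefs_of n g); rewrite monicE /lead_coef size_monic_of /= => /eqP ->.
by move: gm; rewrite monicE /lead_coef sg => /eqP.
Qed.

Notation "g ^emb" := (map_poly emb g) (at level 2, format "g ^emb").

Definition root_sum (g : {poly 'F_p}) : K := \sum_(x <- roots_of g^emb) f^emb.[x].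
(* [L_coef n] below is the coefficient of [t ^ n] in the Artin L-function
   \sum_g lam g t ^ deg g, over monic [g]. *)
Definition lam (g : {poly 'F_p}) : C := psi (descend (root_sum g)).

Lemma emb_monic g : g \is monic -> g^emb \is monic.
Proof. by rewrite map_monic. Qed.

Lemma frob_horner (x : K) : f^emb.[x] ^+ p = f^emb.[x ^+ p].
Proof. by have := horner_map frob f^emb x; rewrite map_frob_emb => /esym. Qed.

(** Frobenius permutes the roots of [g]; hence [root_sum g] lies in the prime field and [descend]
    does not return its junk value there. *)
Lemma root_sum_fixed g : g \is monic -> root_sum g ^+ p = root_sum g.
Proof.
move=> gm; rewrite -[p]expn1 sum_exp_pchar // expn1 /root_sum.
under eq_bigr => x _ do rewrite frob_horner.
rewrite -[LHS](big_map (fun x => x ^+ p) xpredT (fun x => f^emb.[x])).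
by apply: perm_big; rewrite perm_frob_roots ?emb_monic ?map_frob_emb.
Qed.

Lemma lamM g h : g \is monic -> h \is monic -> lam (g * h) = lam g * lam h.
Proof.
move=> gm hm; rewrite /lam -psiD -descendD ?root_sum_fixed //.
rewrite /root_sum rmorphM /= (perm_big _ (perm_roots_ofM _ _)) ?emb_monic //.
by rewrite big_cat.
Qed.

(** On the field with [p ^ n] elements this is the trace of [f x] to the prime field, and
    [ext_sum n] is the sum [S_n] of the overview. *)
Definition trace_sum n (x : K) : K := \sum_(i < n) f^emb.[x] ^+ (p ^ i).
Definition ext_sum n : C := \sum_(x <- fixed_points n) psi (descend (trace_sum n x)).
Definition L_coef n : C := \sum_(a : {ffun 'I_n -> 'F_p}) lam (monic_of a).

Lemma frob_horner_iter i (x : K) : f^emb.[x] ^+ (p ^ i) = f^emb.[x ^+ (p ^ i)].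
Proof.
elim: i x => [|i IH] x; first by rewrite !expr1.
by rewrite expnSr !exprM IH frob_horner.
Qed.

(** Links the L-function to the sums [S_n]: the roots of [orbit_poly n x] are the conjugates of [x],
    so [root_sum] becomes a trace. *)
Lemma descend_orbit n x : (0 < n)%N -> x ^+ (p ^ n) = x ->
  exists g, [/\ g^emb = orbit_poly n x, g \is monic, size g = n.+1
               & lam g = psi (descend (trace_sum n x))].
Proof.
move=> n0 xn; have [g gE] := descend_poly (map_frob_orbit_poly xn).
exists g; split=> //.
- by rewrite -(map_monic emb) -gE orbit_poly_monic.
- by rewrite -(size_map_poly emb) -gE size_orbit_poly.
rewrite /lam /root_sum -gE (perm_big _ (perm_roots_of _)) /orbit_seq big_map big_mkord.
by congr (psi (descend _)); apply: eq_bigr => i _; rewrite frob_horner_iter.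
Qed.

(** Division by [P] is a bijection from its monic multiples of degree [n] to the monic polynomials
    of degree [n - m], and [lam] is multiplicative. *)
Lemma sum_multiples n m (P : {poly 'F_p}) : P \is monic -> size P = m.+1 ->
  \sum_(a : {ffun 'I_n -> 'F_p} | P %| monic_of a) lam (monic_of a)
  = if (m <= n)%N then lam P * L_coef (n - m) else 0.
Proof.
move=> Pm sP; have P0 := monic_neq0 Pm; case: ifP => [le_mn|/negbT]; last first.
  rewrite -ltnNge => lt_nm; rewrite big1 // => a /(dvdp_leq (monic_neq0 (monic_of_monic a))).
  by rewrite sP size_monic_of ltnS leqNgt lt_nm.
have sM (b : {ffun 'I_(n - m) -> 'F_p}) : size (P * monic_of b) = n.+1.
  by rewrite size_monicM ?monic_neq0 ?monic_of_monic // sP size_monic_of addnS /= addSn subnKC.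
have mM (b : {ffun 'I_(n - m) -> 'F_p}) : P * monic_of b \is monic.
  by rewrite monicMl ?monic_of_monic.
rewrite (reindex_onto (fun b => coefs_of n (P * monic_of b))
           (fun a => coefs_of (n - m) (monic_of a %/ P))) /=; last first.
  move=> a Pa; rewrite coefs_ofK.
  - by rewrite mulrC divpK // monic_ofK.
  - by rewrite -(monicMl _ Pm) mulrC divpK // monic_of_monic.
  by rewrite size_divp // size_monic_of sP subSn.
rewrite /L_coef big_distrr /=; apply: eq_big => b.
  by rewrite coefs_ofK ?mM ?sM // dvdp_mulr //= mulrC mulpK // monic_ofK eqxx.
by move=> _; rewrite coefs_ofK ?mM ?sM // lamM ?monic_of_monic.
Qed.

(** The coefficient of [t ^ n] in [t L' = L * \sum_(j > 0) S_j t ^ j]. The degree [n] of each [g] is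
    expanded by [sum_orbit_dvd], and exchanging the sums leaves sums over multiples. *)
Lemma log_derivative n : n%:R * L_coef n = \sum_(j < n) ext_sum j.+1 * L_coef (n - j.+1).
Proof.
rewrite /L_coef big_distrr /=.
transitivity (\sum_(a : {ffun 'I_n -> 'F_p}) \sum_(j < n) \sum_(x <- fixed_points j.+1)
   (if orbit_poly j.+1 x %| (monic_of a)^emb then lam (monic_of a) else 0)).
  apply: eq_bigr => a _; rewrite -{1}(@sum_orbit_dvd n (monic_of a)^emb).
  - rewrite big_mkord natr_sum mulr_suml; apply: eq_bigr => j _.
    rewrite natr_sum mulr_suml; apply: eq_bigr => x _.
    by case: ifP => _; rewrite ?mul1r ?mul0r.
  - by rewrite emb_monic ?monic_of_monic.
  - by rewrite size_map_poly size_monic_of.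
  by rewrite map_frob_emb.
rewrite exchange_big /=; apply: eq_bigr => j _.
rewrite exchange_big /= /ext_sum mulr_suml big_seq [RHS]big_seq; apply: eq_bigr => x.
rewrite mem_fixed_points // => /eqP /(descend_orbit (ltn0Sn j)) [P [PE Pm sP <-]].
transitivity (\sum_(a : {ffun 'I_n -> 'F_p} | P %| monic_of a) lam (monic_of a)).
  by rewrite [RHS]big_mkcond; apply: eq_bigr => a _; rewrite -PE dvdp_map.
by rewrite (sum_multiples _ Pm sP) ltn_ord.
Qed.

Hypotheses (sf : size f = d.+1) (pd : ~~ (p %| d)%N).

Let d0 : (0 < d)%N.
Proof. by case: (d) pd => //; rewrite dvdn0. Qed.

Lemma root_sumE g : root_sum g = \sum_(l < d.+1) emb f`_l * psum (roots_of g^emb) l.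
Proof.
rewrite /root_sum /psum.
under eq_bigr => x _ do rewrite horner_coef size_map_poly sf.
rewrite exchange_big /=; apply: eq_bigr => l _; rewrite big_distrr /=.
by apply: eq_bigr => x _; rewrite coef_map.
Qed.

Lemma psum_rec (rs : seq K) k :
  psum rs k.+1 = - (k.+1%:R * (epoly rs)`_k.+1
                    + \sum_(j < k) psum rs j.+1 * (epoly rs)`_(k.+1 - j.+1)).
Proof.
have := newton rs k.+1; rewrite big_ord_recr /= subnn epoly0 mulr1 addrA => /eqP.
by rewrite addrC addr_eq0 => /eqP.
Qed.

Lemma coef_epoly_roots n g k : g \is monic -> size g = n.+1 -> (k <= n)%N ->
  (epoly (roots_of g^emb))`_k = emb g`_(n - k).
Proof.
move=> gm sg le_kn; have gm' := emb_monic gm.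
have sr : size (roots_of g^emb) = n.
  by apply: succn_inj; rewrite -size_roots_of // size_map_poly.
by rewrite -coef_epoly_prod ?sr // roots_ofE // coef_map.
Qed.

(* Changing the [d]-th highest coefficient of [g] leaves the first [d - 1]
   power sums of its roots unchanged and shifts the [d]-th one. *)
Lemma root_sum_shift n g t : g \is monic -> size g = n.+1 -> (d <= n)%N ->
  root_sum (g + t *: 'X^(n - d)) = root_sum g - emb (d%:R * f`_d * t).
Proof.
move=> gm sg le_dn; set h := g + _.
have nd : (n - d < n)%N by rewrite ltn_subrL d0 (leq_trans d0).
have st : (size (t *: 'X^(n - d)) < size g)%N.
  by rewrite (leq_ltn_trans (size_scale_leq _ _)) // size_polyXn sg ltnS.
have hm : h \is monic by rewrite monicE /h lead_coefDl // -monicE.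
have sh : size h = n.+1 by rewrite /h size_polyDl.
(* Among the first [d] coefficients of [epoly] after the constant one, only the [d]-th moves;
   Newton's identities carry this over to the power sums. *)
have cE k : (k <= d)%N -> (epoly (roots_of h^emb))`_k
    = (epoly (roots_of g^emb))`_k + (if k == d then emb t else 0).
  move=> le_kd; have le_kn := leq_trans le_kd le_dn.
  rewrite (coef_epoly_roots hm sh) // (coef_epoly_roots gm sg) // /h coefD coefZ coefXn.
  rewrite rmorphD /=; congr (_ + _).
  have -> : (n - k == n - d)%N = (k == d) by rewrite eqn_sub2lE.
  by case: (k == d); rewrite ?mulr1 ?mulr0 ?rmorph0.
have cE' k : (k < d)%N -> (epoly (roots_of h^emb))`_k = (epoly (roots_of g^emb))`_k.
  by move=> lt_kd; rewrite cE 1?ltnW // ltn_eqF // addr0.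
have pE k : (k < d)%N -> psum (roots_of h^emb) k.+1
    = psum (roots_of g^emb) k.+1 - k.+1%:R * (if k.+1 == d then emb t else 0).
  elim/ltn_ind: k => k IHk lt_kd; rewrite !psum_rec cE // mulrDr.
  rewrite addrAC opprD; congr (- (_ + _) - _).
  apply: eq_bigr => j _; have lt_jk := ltn_ord j.
  rewrite IHk // 1?(ltn_trans lt_jk) // (ltn_eqF (leq_ltn_trans lt_jk lt_kd)).
  rewrite mulr0 subr0 cE' //; apply: leq_ltn_trans lt_kd; rewrite leq_subLR; lia.
have p0E : psum (roots_of h^emb) 0 = psum (roots_of g^emb) 0.
  rewrite /psum; under eq_bigr => x _ do rewrite expr0.
  under [RHS]eq_bigr => x _ do rewrite expr0.
  rewrite !big_const_seq !count_predT !iter_addr_0; congr (_ *+ _).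
  apply: succn_inj; rewrite -!size_roots_of ?emb_monic //.
  by rewrite !size_map_poly sh sg.
rewrite !root_sumE !big_ord_recr /= -addrA; congr (_ + _).
  apply: eq_bigr => -[[|k] lt_kd] _ /=; first by rewrite p0E.
  by rewrite pE 1?ltnW // (ltn_eqF lt_kd) mulr0 subr0.
have := pE d.-1; rewrite prednK // leqnn eqxx => /(_ isT) ->.
by rewrite mulrBr; congr (_ - _); rewrite !rmorphM rmorph_nat; ring.
Qed.

Hypothesis psi_nontriv : exists c, psi c != 1.

(** Translating the [d]-th highest coefficient permutes the monic polynomials of degree [n] and
    multiplies every [lam] by the same [psi c != 1]. *)
Lemma L_coef_eq0 n : (d <= n)%N -> L_coef n = 0.
Proof.
move=> le_dn; have [c psic] := psi_nontriv.
have lf0 : f`_d != 0.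
  have : lead_coef f != 0 by rewrite lead_coef_eq0 -size_poly_gt0 sf.
  by rewrite lead_coefE sf.
have df0 : d%:R * f`_d != 0 :> 'F_p.
  by rewrite mulf_neq0 // -(dvdn_pcharf (pchar_Fp pp)).
(* Chosen so that the shift [- d f_d t] of [root_sum] equals [c]. *)
pose t := - (c / (d%:R * f`_d)).
have nd : (n - d < n)%N by rewrite ltn_subrL d0 (leq_trans d0).
pose sh : {ffun 'I_n -> 'F_p} := [ffun i => if i == Ordinal nd then t else 0].
have mS a : monic_of (a + sh) = monic_of a + t *: 'X^(n - d).
  rewrite /monic_of -addrA; congr (_ + _).
  under eq_bigr => i _ do rewrite ffunE scalerDl.
  rewrite big_split /=; congr (_ + _); rewrite (bigD1 (Ordinal nd)) //= big1 ?addr0.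
    by rewrite ffunE eqxx.
  by move=> i ni; rewrite ffunE (negPf ni) scale0r.
have AE : L_coef n = L_coef n * psi c.
  rewrite {1}/L_coef (reindex_inj (addIr sh)) /= /L_coef mulr_suml; apply: eq_bigr => a _.
  have am := monic_of_monic a.
  rewrite mS /lam (@root_sum_shift n) ?size_monic_of // -rmorphN.
  rewrite descendD ?root_sum_fixed -?rmorphXn ?expFp // descend_emb psiD.
  by congr (_ * psi _); rewrite /t mulrN opprK mulrC divfK.
have : L_coef n * (psi c - 1) = 0 by rewrite mulrBr -AE mulr1 subrr.
by move/eqP; rewrite mulf_eq0 subr_eq0 (negPf psic) orbF => /eqP.
Qed.

Lemma L_coef0 : L_coef 0 = 1.
Proof.
rewrite /L_coef (big_pred1 [ffun i : 'I_0 => 0]); last first.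
  by move=> a; apply/esym/eqP/ffunP; case.
rewrite /lam /root_sum /monic_of big_ord0 addr0 expr0 rmorph1.
have := size_roots_of (monic1 K); rewrite size_poly1 => -[/esym/eqP].
by rewrite size_eq0 => /eqP ->; rewrite big_nil -(rmorph0 emb) descend_emb.
Qed.

End LFunction.

(** * Weil's bound *)

Section Weil.
Variables (p : nat) (K : closedFieldType) (pK : p \in [pchar K]).
Variable emb : {rmorphism 'F_p -> K}.
Variables (C : numClosedFieldType) (psi : 'F_p -> C) (f : {poly 'F_p}) (d : nat).
Hypotheses (psi0 : psi 0 = 1) (psiD : forall a b, psi (a + b) = psi a * psi b).
Hypothesis psi_nontriv : exists c, psi c != 1.
Hypotheses (sf : size f = d.+1) (pd : ~~ (p %| d)%N).

Let pp : prime p := pcharf_prime pK.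
Let p0 : (0 < p)%N := prime_gt0 pp.
Let d0 : (0 < d)%N.
Proof. by case: (d) pd => //; rewrite dvdn0. Qed.

Let psiX a n : psi (a *+ n) = psi a ^+ n.
Proof. by elim: n => [|n IH]; rewrite ?mulr0n ?psi0 // mulrS psiD IH exprS. Qed.

Let psi_root a : psi a ^+ p = 1.
Proof. by rewrite -psiX -mulr_natr pchar_Fp_0 // mulr0 psi0. Qed.

Let psi_norm a : `|psi a| = 1.
Proof. by apply/eqP; rewrite -(@pexpr_eq1 _ _ p) // -normrX psi_root normr1. Qed.

Let psi_algQ a : algQ (psi a).
Proof.
exists ('X^p - 1); first by rewrite monicE lead_coefDl ?lead_coefXn // size_polyN size_poly1 size_polyXn ltnS.
by rewrite rmorphB rmorph1 /= map_polyXn rootE !hornerE psi_root subrr.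
Qed.

Let sum_psi : \sum_a psi a = 0.
Proof.
have [c c1] := psi_nontriv.
have E : \sum_a psi a = (\sum_a psi a) * psi c.
  by rewrite {1}(reindex_inj (addIr c)) mulr_suml; apply: eq_bigr => a _; rewrite psiD.
have : (\sum_a psi a) * (psi c - 1) = 0 by rewrite mulrBr -E mulr1 subrr.
by move/eqP; rewrite mulf_eq0 subr_eq0 (negPf c1) orbF => /eqP.
Qed.

Local Notation extS := (ext_sum emb psi f).
Local Notation LC := (L_coef emb psi f).

(** Newton's identities for the inverse roots of the L-function and [log_derivative] are the same
    recursion up to sign, so [conv_eq0] identifies the two sequences. *)
Lemma L_roots : exists ws : seq C, [/\ size ws = d.-1, {in ws, forall w, algQ w}
  & forall n, extS n.+1 = - psum ws n.+1].
Proof.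
(* The coefficients are reversed, so that [L] is monic and [epoly] of its roots is the L-function
   itself. *)
pose L : {poly C} := \poly_(i < d) LC (d.-1 - i).
have A0 : LC 0 = 1 by apply: L_coef0.
have Ld : L`_d.-1 = 1 by rewrite coef_poly prednK // leqnn subnn A0.
have sL : size L = d by apply: size_poly_eq; rewrite subnn A0 oner_neq0.
have Lm : L \is monic by rewrite monicE /lead_coef sL Ld.
have [ws wsE] := closed_field_poly_normal L.
rewrite (monicP Lm) scale1r in wsE.
have sws : size ws = d.-1.
  by apply: succn_inj; rewrite prednK // -sL wsE size_prod_XsubC.
exists ws; split=> // [w ws_w|].
  apply: (integral_root_monic Lm); first by rewrite wsE root_prod_XsubC.
  apply/integral_poly => i; rewrite coef_poly; case: ifP => _; last exact: integral0.
  by rewrite -[integralOver _ _]/(algQ _); apply: algQ_sum => a _; apply: psi_algQ.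
have eE k : (epoly ws)`_k = LC k.
  have [le_k|lt_k] := leqP k d.-1.
    have lt_kd : (d.-1 - k < d)%N by have := d0; lia.
    by rewrite -coef_epoly_prod sws // -wsE coef_poly lt_kd subKn.
  rewrite epoly_top ?sws // (L_coef_eq0 pK emb psiD sf pd psi_nontriv) //.
  by rewrite -(prednK d0).
move=> n; apply/eqP; rewrite -addr_eq0; apply/eqP.
apply: (@conv_eq0 _ (fun j => extS j.+1 + psum ws j.+1) LC) => // {}n.
under eq_bigr => j _ do rewrite mulrDl.
rewrite big_split /= -(log_derivative pK emb f psiD) -[RHS](newton ws n) eE.
by congr (_ + _); apply: eq_bigr => j _; rewrite eE.
Qed.

(** The degree is even because Stepanov's method halves the trace. The bound for each of the [p]
    fibres exceeds their average [p ^ n / p] by [(2 d + 1) p ^ (a + 1)]. *)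
Lemma ext_sum_bound a :
  `|extS (a.+1 + a.+1)| <= ((2 * d + 1) * p)%:R * (p ^ a.+1)%:R.
Proof.
set n := (a.+1 + a.+1)%N.
pose Z b := [seq x <- @fixed_points p K n | descend emb (trace_sum emb f n x) == b].
have sumE (F : 'F_p -> C) : \sum_(x <- @fixed_points p K n) F (descend emb (trace_sum emb f n x))
    = \sum_b F b * (size (Z b))%:R.
  rewrite (partition_big (fun x => descend emb (trace_sum emb f n x)) xpredT) //=.
  apply: eq_bigr => b _; rewrite (eq_bigr (fun=> F b)) => [|x /eqP -> //].
  by rewrite big_const_seq iter_addr_0 -[LHS]mulr_natr /Z size_filter.
have trace_fixed x : x ^+ (p ^ n) = x -> trace_sum emb f n x ^+ p = trace_sum emb f n x.
  move=> xn; rewrite /trace_sum.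
  have := sum_exp_pchar pK (index_enum 'I_n) (fun i => (map_poly emb f).[x] ^+ (p ^ i)) 1.
  rewrite !expn1 => ->; rewrite big_ord_recr [RHS]big_ord_recl /=.
  rewrite expr1 -exprM -expnSr -/n (frob_horner_iter pK) xn addrC; congr (_ + _).
  by apply: eq_bigr => i _; rewrite -exprM -expnSr.
have sZ b : (size (Z b) <= p ^ a * p ^ a.+1 + (2 * d + 1) * p ^ a.+1)%N.
  apply: (@stepanov _ _ pK (map_poly emb f) d a (emb b)) => //.
  - by rewrite size_map_poly.
  - by rewrite filter_uniq // uniq_fixed_points.
  - move=> x; rewrite mem_filter => /andP[_].
    by rewrite mem_fixed_points // -expnD => /eqP.
  move=> x; rewrite mem_filter => /andP[/eqP <-].
  rewrite (mem_fixed_points pK) // => /eqP xn; rewrite (descendK pK) //.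
  exact: trace_fixed.
have total : \sum_b (size (Z b))%:R = (p ^ n)%:R :> C.
  have := sumE (fun=> 1); under [X in _ = X -> _]eq_bigr => b _ do rewrite mul1r.
  by move=> <-; rewrite big_const_seq iter_addr_0 count_predT size_fixed_points.
(* [psi] sums to [0], so the upper bounds for the fibres suffice *)
set U := (_ + _)%N in sZ.
have -> : extS n = - \sum_b psi b * (U - size (Z b))%:R.
  under [in RHS]eq_bigr => b _ do rewrite natrB // mulrBr.
  by rewrite sumrB -mulr_suml sum_psi mul0r sub0r opprK /ext_sum (sumE psi).
rewrite normrN; apply: le_trans (ler_norm_sum _ _ _) _.
under eq_bigr => b _ do rewrite normrM psi_norm mul1r normr_nat natrB //.
rewrite sumrB total sumr_const card_Fp // -natrM -mulrnA.
have qE : (p ^ n = p ^ a * p ^ a.+1 * p)%N by rewrite /n expnD {1}expnSr mulnAC.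
by rewrite lerBlDr -natrD ler_nat /U qE; apply: eq_leq; ring.
Qed.

Lemma sum_psi_bound_ext : `|\sum_a psi f.[a]| <= d.-1%:R * sqrtC p%:R.
Proof.
have [ws [sws aws wsE]] := L_roots.
have pC : 0 < (p%:R : C) by rewrite ltr0n.
have w_le w : w \in ws -> `|w| <= sqrtC p%:R.
  (* The [k]-th power sum of the numbers [w ^ 2 / p] is [- S_(2 k) / p ^ k], which is bounded
     independently of [k]. *)
  move=> ws_w; pose us := [seq w ^+ 2 / p%:R | w <- ws].
  have us_le : `|w ^+ 2 / p%:R| <= 1.
    apply: (@norm_le1_of_bounded_psums _ us ((2 * d + 1) * p)); last exact: map_f.
      move=> _ /mapP[v /aws av ->]; apply: integral_div; last exact: algQ_nat.
      exact: integral_mul.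
    case=> // a _; rewrite /psum big_map.
    have -> : \sum_(v <- ws) (v ^+ 2 / p%:R) ^+ a.+1 = - extS (a.+1 + a.+1) / (p ^ a.+1)%:R.
      rewrite [in extS _]addSn wsE opprK mulr_suml; apply: eq_bigr => v _.
      by rewrite exprMn exprVn natrX -exprM mul2n -addnn addSn.
    by rewrite normrM normrN normfV normr_nat ler_pdivrMr ?ext_sum_bound // ltr0n expn_gt0 p0.
  rewrite -(@ler_pXn2r _ 2) ?nnegrE ?sqrtC_ge0 ?ler0n // sqrtCK -normrX.
  by move: us_le; rewrite normrM normfV normr_nat ler_pdivrMr // mul1r.
have -> : \sum_a psi f.[a] = extS 1.
  rewrite /ext_sum (perm_big (map emb (enum 'F_p))) /=.
    rewrite big_map big_enum; apply: eq_bigr => a _.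
    by rewrite /trace_sum big_ord1 expr1 horner_map descend_emb.
  apply: uniq_perm; first exact: uniq_fixed_points.
    by rewrite map_inj_uniq ?enum_uniq //; apply: fmorph_inj.
  move=> x; rewrite mem_fixed_points // expn1; apply/eqP/mapP => [/(frob_fixedP pK emb)[a ->]|[a _ ->]].
    by exists a; rewrite ?mem_enum.
  by rewrite -rmorphXn (expFp pK).
rewrite wsE normrN /psum; apply: le_trans (ler_norm_sum _ _ _) _.
rewrite big_seq; under eq_bigr => w _ do rewrite expr1.
apply: le_trans (ler_sum _ w_le) _.
by rewrite -big_seq big_const_seq count_predT iter_addr_0 sws mulr_natl.
Qed.

End Weil.

Theorem weil_bound (p : nat) (C : numClosedFieldType) (psi : 'F_p -> C) (f : {poly 'F_p}) d :
  prime p -> psi 0 = 1 -> (forall a b, psi (a + b) = psi a * psi b) ->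
  (exists c, psi c != 1) -> size f = d.+1 -> ~~ (p %| d)%N ->
  `|\sum_a psi f.[a]| <= d.-1%:R * sqrtC p%:R.
Proof.
move=> pp psi0 psiD psi1 sf pd.
have [K [emb _]] := countable_algebraic_closure 'F_p.
have pK : p \in [pchar K] by rewrite (fmorph_pchar emb) pchar_Fp.
exact: (sum_psi_bound_ext pK emb).
Qed.

(** * Sparse recovery from incoherence *)

Section Recovery.
Variables (C : numClosedFieldType) (q d N : nat).
Local Notation J := (Kidx q d).
Local Notation F := (@FXmul C q d N).
Local Notation adj := (@FXadj C q d N).
Implicit Types (z w u : cvec C q d) (r y v : svec C N) (L T : {set J}) (k : J).

Definition gram k k' : C := \sum_(i < N) (FX C i k)^* * FX C i k'.
Definition l2sq v : C := \sum_i `|v i| ^+ 2.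
Definition axpy (t : C) z w : cvec C q d := [ffun k => z k + t * w k].
Definition single k : cvec C q d := [ffun k' => (k' == k)%:R].
Definition inner v r : C := \sum_i (v i)^* * r i.

Lemma svecB v r i : (v - r) i = v i - r i.
Proof. by rewrite !ffunE. Qed.

Lemma FXmulB z w : F (z - w) = F z - F w.
Proof.
apply/ffunP => i; rewrite !ffunE -sumrB; apply: eq_bigr => k _.
by rewrite !ffunE mulrBr.
Qed.

Lemma FXmul0 : F 0 = 0.
Proof. by rewrite -(subrr (0 : cvec C q d)) FXmulB subrr. Qed.

Lemma FXmul_axpy t z w i : F (axpy t z w) i = F z i + t * F w i.
Proof.
rewrite !ffunE big_distrr -big_split /=; apply: eq_bigr => k _.
by rewrite !ffunE; ring.
Qed.

Lemma FXmul_single k i : F (single k) i = FX C i k.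
Proof.
rewrite ffunE (bigD1 k) //= ffunE eqxx mulr1 big1 ?addr0 // => k' /negPf kk'.
by rewrite ffunE kk' mulr0.
Qed.

Lemma FXadj_mul w k : adj (F w) k = \sum_k' gram k k' * w k'.
Proof.
rewrite ffunE; under eq_bigr => i _ do rewrite ffunE big_distrr /=.
rewrite exchange_big /=; apply: eq_bigr => k' _; rewrite mulr_suml.
by apply: eq_bigr => i _; rewrite mulrA.
Qed.

Lemma FXadjE r k : adj r k = inner (F (single k)) r.
Proof. by rewrite ffunE; apply: eq_bigr => i _; rewrite FXmul_single. Qed.

Lemma inner_FXmul u r : inner (F u) r = \sum_k (u k)^* * adj r k.
Proof.
rewrite /inner; under eq_bigr => i _ do rewrite ffunE rmorph_sum mulr_suml /=.
rewrite exchange_big /=; apply: eq_bigr => k _; rewrite ffunE big_distrr /=.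
by apply: eq_bigr => i _; rewrite rmorphM /=; ring.
Qed.

Lemma inner_self v : inner v v = l2sq v.
Proof. by apply: eq_bigr => i _; rewrite normCKC. Qed.

Lemma l2sq_ge0 v : 0 <= l2sq v.
Proof. by apply: sumr_ge0 => i _; rewrite exprn_ge0. Qed.

Lemma l2sq_eq0 v : l2sq v = 0 -> v = 0.
Proof.
move/eqP; rewrite psumr_eq0 => [/allP v0|i _]; last by rewrite exprn_ge0.
apply/ffunP => i; rewrite ffunE; apply/eqP.
by have := v0 i (mem_index_enum i); rewrite /= expf_eq0 /= normr_eq0.
Qed.

Lemma l2norm_le v r : (l2norm v <= l2norm r) = (l2sq v <= l2sq r).
Proof. by rewrite ler_sqrtC ?nnegrE ?l2sq_ge0. Qed.

Lemma l2sq_sub r v :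
  l2sq (r - v) = l2sq r - inner v r - (inner v r)^* + l2sq v.
Proof.
rewrite /l2sq /inner rmorph_sum -!sumrB -big_split /=; apply: eq_bigr => i _.
by rewrite !ffunE !normCK rmorphB rmorphM /= conjCK; ring.
Qed.

Lemma suppP z L : reflect (forall k, k \notin L -> z k = 0) (supp z \subset L).
Proof.
apply: (iffP subsetP) => [H k|H k]; first by move/(contra (H k)); rewrite inE negbK => /eqP.
by rewrite inE; apply: contraNT => /H ->.
Qed.

Definition normal_eqs L y z := forall k, k \in L -> adj (y - F z) k = 0.

Definition least_squares L y z := supp z \subset L /\
  (forall z' : cvec C q d, supp z' \subset L -> l2norm (y - F z) <= l2norm (y - F z')).

(** Pythagoras: [F (z' - z)] lies in the span of the columns in [L], to which the residual is
    orthogonal. *)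
Lemma normal_eqs_least_squares L y z :
  supp z \subset L -> normal_eqs L y z -> least_squares L y z.
Proof.
move=> zL nz; split=> // z' z'L; rewrite l2norm_le.
have -> : y - F z' = (y - F z) - F (z' - z) by rewrite FXmulB opprB addrA subrK.
have i0 : inner (F (z' - z)) (y - F z) = 0.
  rewrite inner_FXmul big1 // => k _; have [kL|kL] := boolP (k \in L).
    by rewrite nz ?mulr0.
  by rewrite !ffunE (suppP _ _ zL) ?(suppP _ _ z'L) // subr0 rmorph0 mul0r.
by rewrite [leRHS]l2sq_sub i0 rmorph0 !subr0 lerDl l2sq_ge0.
Qed.

(* Gram-Schmidt on the columns indexed by [s] *)
Lemma normal_eqs_solvable (s : seq J) y :
  exists z, (forall k, k \notin s -> z k = 0) /\ (forall k, k \in s -> adj (y - F z) k = 0).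
Proof.
elim: s y => [|k s IH] y; first by exists 0; split=> // k _; rewrite ffunE.
have [z [zs hz]] := IH y; have [u [us hu]] := IH (F (single k)).
pose v := single k - u; pose r := y - F z; pose e := F v.
have eE : e = F (single k) - F u by rewrite /e FXmulB.
have u_adj r' : (forall j, j \in s -> adj r' j = 0) -> inner (F u) r' = 0.
  move=> H; rewrite inner_FXmul big1 // => j _; have [js|js] := boolP (j \in s).
    by rewrite H ?mulr0.
  by rewrite us // rmorph0 mul0r.
have k_adj r' : (forall j, j \in s -> adj r' j = 0) -> adj r' k = inner e r'.
  move=> H; rewrite FXadjE -[LHS]subr0 -(u_adj r' H) eE /inner -sumrB.
  by apply: eq_bigr => i _; rewrite !ffunE rmorphB mulrBl.
(* If the part [e] of column [k] orthogonal to the columns in [s] vanishes, [z] already works;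
   otherwise the component of the residual along [e] is removed. *)
have [e0|e0] := eqVneq (l2sq e) 0.
  exists z; split=> j; rewrite inE ?negb_or; first by case/andP => _ /zs.
  case/orP => [/eqP ->|/hz //].
  rewrite (k_adj _ hz) (l2sq_eq0 e0) /inner big1 // => i _.
  by rewrite ffunE rmorph0 mul0r.
pose t := inner e r / l2sq e; exists (axpy t z v).
have rE : y - F (axpy t z v) = [ffun i => r i - t * e i].
  by apply/ffunP => i; rewrite svecB FXmul_axpy opprD addrA -svecB [RHS]ffunE.
have adjE j : adj (y - F (axpy t z v)) j = adj r j - t * adj e j.
  rewrite rE !ffunE big_distrr -sumrB; apply: eq_bigr => i _; rewrite ffunE /=; ring.
have hs j : j \in s -> adj (y - F (axpy t z v)) j = 0.
  by move=> js; rewrite adjE hz // eE hu // mulr0 subr0.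
split=> j; rewrite inE ?negb_or.
  case/andP => jk js; rewrite ffunE zs // !ffunE (negPf jk) us // subr0 mulr0; ring.
case/orP => [/eqP ->|/hs //]; rewrite (k_adj _ hs) rE.
have -> : inner e [ffun i => r i - t * e i] = inner e r - t * l2sq e.
  rewrite -inner_self /inner big_distrr -sumrB; apply: eq_bigr => i _.
  by rewrite [X in _ * X]ffunE mulrBr mulrCA.
by rewrite /t divfK // subrr.
Qed.

Lemma least_squares_exists L y : exists z, least_squares L y z.
Proof.
have [z [zL hz]] := normal_eqs_solvable (enum L) y; exists z.
apply: normal_eqs_least_squares => [|k kL]; last by apply: hz; rewrite mem_enum.
by apply/suppP => k kL; apply: zL; rewrite mem_enum.
Qed.

Lemma argmax_exists (h : cvec C q d) : exists kmax, forall k, `|h k| <= `|h kmax|.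
Proof.
have k0 : J by refine [ffun=> Ordinal (_ : 0 < 2 * q + 1)%N]; rewrite addn1.
case: (@real_arg_maxP C J k0 xpredT (fun k => `|h k|)) => // [k _|k _ H].
  exact: normr_real.
by exists k => j; apply: H.
Qed.

(** Ensures that the recovery statement, which quantifies over all runs, is not vacuous. *)
Lemma omp_run_exists M y : exists Lam cs, @omp_run C q d N M y Lam cs.
Proof.
elim: M => [|M [Lam [cs [L0 [c0 run]]]]].
  by exists (fun=> set0), (fun=> 0).
have [kmax kP] := argmax_exists (adj (y - F (cs M))).
have [z [zL zmin]] := least_squares_exists (kmax |: Lam M) y.
exists (fun l => if (l <= M)%N then Lam l else kmax |: Lam M).
exists (fun l => if (l <= M)%N then cs l else z).
split=> //; split=> // l lM.
have /predU1P[->|lt_lM] : (l == M) || (l < M)%N by rewrite -leq_eqVlt.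
  by rewrite leqnn ltnn; split; first by exists kmax.
by rewrite lt_lM (ltnW lt_lM); apply: run.
Qed.

Variables (M : nat) (mu : C).
Hypotheses (mu_ge0 : 0 <= mu) (N_gt0 : (0 < N)%N).
Hypothesis gram_diag : forall k, gram k k = N%:R.
Hypothesis gram_off : forall k k', k != k' -> `|gram k k'| <= mu.
(** The condition [(2 M - 1) mu < N], with one [mu] moved across. *)
Hypothesis incoherent : (2 * M)%:R * mu < N%:R + mu.

Let Nmu_gt0 : 0 < N%:R + mu.
Proof. by rewrite ltr_wpDr // ltr0n. Qed.

Lemma gram_deviation w k :
  `|adj (F w) k - N%:R * w k| <= mu * (l1norm w - `|w k|).
Proof.
rewrite FXadj_mul (bigD1 k) //= gram_diag addrAC subrr add0r.
have -> : l1norm w - `|w k| = \sum_(j | j != k) `|w j|.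
  by rewrite /l1norm (bigD1 k) //= addrAC subrr add0r.
apply: le_trans (ler_norm_sum _ _ _) _; rewrite mulr_sumr; apply: ler_sum => j jk.
by rewrite normrM ler_wpM2r // gram_off // eq_sym.
Qed.

(** A kernel vector cannot concentrate on one coordinate: row [k] of the Gram matrix balances
    [N w_k] against off-diagonal entries of modulus at most [mu]. *)
Lemma kernel_spread w k : F w = 0 -> (N%:R + mu) * `|w k| <= mu * l1norm w.
Proof.
move=> w0; have := gram_deviation w k; rewrite w0.
have -> : adj 0 k = 0 by rewrite ffunE big1 // => i _; rewrite ffunE mulr0.
by rewrite sub0r normrN normrM normr_nat mulrBr lerBrDr -mulrDl.
Qed.

Lemma kernel_sum T w : F w = 0 ->
  (N%:R + mu) * \sum_(k in T) `|w k| <= #|T|%:R * (mu * l1norm w).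
Proof.
move=> w0; rewrite mulr_sumr mulr_natl -sumr_const; apply: ler_sum => k _.
exact: kernel_spread.
Qed.

Lemma l1norm_ge0 w : 0 <= l1norm w.
Proof. by apply: sumr_ge0. Qed.

Lemma l1norm_gt0 w : w != 0 -> 0 < l1norm w.
Proof.
move=> w0; rewrite lt0r l1norm_ge0 andbT; apply: contra w0.
rewrite psumr_eq0 // => /allP H; apply/eqP/ffunP => k; rewrite ffunE.
by have := H k (mem_index_enum k); rewrite normr_eq0 => /eqP.
Qed.

Lemma l1norm_supp w T : supp w \subset T -> l1norm w = \sum_(k in T) `|w k|.
Proof.
move/suppP => wT; rewrite /l1norm (bigID [in T]) /= [X in _ + X]big1 ?addr0 // => k kT.
by rewrite wT // normr0.
Qed.

(** Summing [kernel_spread] over [T] bounds the left side by [2 M mu / (N + mu)] times the norm, and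
    this factor is less than [1]. *)
Lemma null_space_property T w : F w = 0 -> w != 0 -> (#|T| <= M)%N ->
  2%:R * \sum_(k in T) `|w k| < l1norm w.
Proof.
move=> w0 wn0 TM; have lw := l1norm_gt0 wn0.
rewrite -(ltr_pM2l Nmu_gt0) mulrCA.
apply: (@le_lt_trans _ _ ((2 * M)%:R * mu * l1norm w)); last by rewrite ltr_pM2r.
apply: le_trans (ler_wpM2l _ (kernel_sum T w0)) _ => //.
by rewrite [leLHS]mulrA -natrM -[leRHS]mulrA ler_wpM2r ?mulr_ge0 ?l1norm_ge0 // ler_nat leq_mul2l.
Qed.

Lemma sparse_kernel T w : F w = 0 -> supp w \subset T -> (#|T| <= 2 * M)%N -> w = 0.
Proof.
move=> w0 wT TM; apply/eqP; apply: contraT => wn0; have lw := l1norm_gt0 wn0.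
have := kernel_sum T w0; rewrite -l1norm_supp // mulrA ler_pM2r //.
move=> le1; have : (N%:R + mu) <= (2 * M)%:R * mu.
  by apply: le_trans le1 _; rewrite ler_wpM2r // ler_nat.
by move/le_lt_trans/(_ incoherent); rewrite ltxx.
Qed.

(** Passing from [c] to [z] loses at most the mass of [w = z - c] on the support of [c] and gains
    its mass off the support, which is larger by the null space property. *)
Lemma basis_pursuit_unique c z : (#|supp c| <= M)%N -> F z = F c -> z != c ->
  l1norm c < l1norm z.
Proof.
move=> cM Fz zc; pose w := z - c.
have w0 : F w = 0 by rewrite FXmulB Fz subrr.
have wn0 : w != 0 by rewrite subr_eq0.
have := null_space_property w0 wn0 cM.
rewrite {1}/l1norm [X in _ < X](bigID [in supp c]) /= mulr_natl mulr2n ltrD2l => lt1.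
rewrite (l1norm_supp (subxx (supp c))) [X in _ < X]/l1norm [X in _ < X](bigID [in supp c]) /=.
rewrite -ltrBlDl.
rewrite -sumrB; apply: le_lt_trans (_ : _ <= \sum_(k in supp c) `|w k|) _.
  apply: ler_sum => k _; rewrite lerBlDr.
  have -> : c k = z k - w k by rewrite !ffunE opprB addrCA subrr addr0.
  by rewrite [leRHS]addrC ler_normB.
apply: lt_le_trans lt1 _; apply: ler_sum => k; rewrite inE negbK => /eqP ck.
by rewrite !ffunE ck subr0.
Qed.

(** Moving [z] by [h / N] along coordinate [k] would lower the squared residual by [|h|^2 / N],
    since each column has squared norm [N]; minimality forces [h = 0]. *)
Lemma least_squares_normal_eqs L y z : least_squares L y z -> normal_eqs L y z.
Proof.
case=> zL zmin k kL; set r := y - F z; set h := adj r k.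
have N0 : (N%:R : C) != 0 by rewrite pnatr_eq0 -lt0n.
pose t := h / N%:R.
have z'L : supp (axpy t z (single k)) \subset L.
  apply/suppP => j jL; rewrite !ffunE (suppP _ _ zL) // add0r.
  by case: eqP jL => [->|_ _]; rewrite ?kL // mulr0.
have := zmin _ z'L; rewrite l2norm_le.
have -> : y - F (axpy t z (single k)) = r - F (axpy t 0 (single k)).
  apply/ffunP => i; rewrite !svecB !FXmul_axpy opprD addrA; congr (_ - _).
  by rewrite FXmul0 [X in _ = X + _]ffunE add0r.
have iE : inner (F (axpy t 0 (single k))) r = t^* * h.
  rewrite inner_FXmul (bigD1 k) //= big1 ?addr0; last first.
    by move=> j /negPf jk; rewrite !ffunE jk mulr0 addr0 rmorph0 mul0r.
  by rewrite -/h; congr (_^* * _); rewrite !ffunE eqxx mulr1 add0r.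
rewrite [leRHS]l2sq_sub iE.
have -> : l2sq (F (axpy t 0 (single k))) = t * t^* * N%:R.
  rewrite -(gram_diag k) /gram mulr_sumr; apply: eq_bigr => i _.
  rewrite FXmul_axpy FXmul0 FXmul_single ffunE add0r.
  by rewrite normCK rmorphM /=; ring.
have -> : l2sq r - t^* * h - (t^* * h)^* + t * t^* * N%:R = l2sq r - `|h| ^+ 2 / N%:R.
  have tc : t^* = h^* / N%:R by rewrite rmorphM fmorphV rmorph_nat.
  have tch : (t^* * h)^* = t * h^* by rewrite [LHS]rmorphM /= conjCK.
  by rewrite tch tc normCK /t; field.
rewrite lerDl oppr_ge0 pmulr_lle0 ?invr_gt0 ?ltr0n // => h0.
have : `|h| ^+ 2 == 0 by rewrite eq_le h0 exprn_ge0.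
by rewrite expf_eq0 /= normr_eq0 => /eqP.
Qed.

(** Take [k0] with [a = |w k0|] maximal. The correlation at [k0] is at least [(N + mu - M mu) a],
    off [T] it is at most [M mu a], and incoherence separates the two. *)
Lemma sparse_dominant w T : supp w \subset T -> (#|T| <= M)%N -> w != 0 ->
  exists2 k0, k0 \in T & 0 < `|adj (F w) k0| /\
    forall k, k \notin T -> `|adj (F w) k| < `|adj (F w) k0|.
Proof.
move=> wT TM w0.
have [k0 k0P] := argmax_exists w; set a := `|w k0| in k0P.
have a0 : 0 < a.
  rewrite normr_gt0; apply: contra w0 => /eqP wk0; apply/eqP/ffunP => k.
  by apply/eqP; rewrite ffunE -normr_le0 (le_trans (k0P k)) // /a wk0 normr0.
have k0T : k0 \in T by apply: contraTT a0 => /(suppP _ _ wT) E; rewrite /a E normr0 ltxx.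
have l1_le : mu * l1norm w <= M%:R * mu * a.
  rewrite (l1norm_supp wT) mulrAC mulrC; apply: ler_wpM2r => //.
  apply: le_trans (_ : _ <= \sum_(k in T) a) _; first exact: ler_sum.
  by rewrite sumr_const -[leLHS]mulr_natl ler_wpM2r ?(ltW a0) // ler_nat.
have hk0 : (N%:R + mu) * a - M%:R * mu * a <= `|adj (F w) k0|.
  have := gram_deviation w k0; rewrite -/a mulrBr => dev.
  have := lerB_dist (N%:R * w k0) (adj (F w) k0).
  rewrite normrM normr_nat -/a distrC => le1.
  have {}le1 := le_trans le1 dev.
  rewrite lerBlDr in le1; rewrite lerBlDr mulrDl; apply: le_trans (lerD le1 (lexx _)) _.
  by rewrite addrAC subrK addrC lerD2l.
have Ma : M%:R * mu * a < (N%:R + mu) * a - M%:R * mu * a.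
  rewrite ltrBrDr -!mulrDl ltr_pM2r //; apply: le_lt_trans incoherent.
  by rewrite mul2n -addnn natrD.
exists k0 => //; split; first by apply: lt_le_trans hk0; apply: le_lt_trans Ma; rewrite !mulr_ge0 // ltW.
move=> k kT; apply: le_lt_trans (lt_le_trans Ma hk0).
have := gram_deviation w k; rewrite (suppP _ _ wT) // mulr0 subr0 normr0 subr0 => /le_trans.
exact.
Qed.

(** The residual is the image of [c - z], supported in [supp c], so the maximum is attained there;
    it is positive, whereas the correlations on [L] vanish. *)
Lemma omp_step c L z kmax : (#|supp c| <= M)%N -> L \subset supp c ->
  supp z \subset L -> normal_eqs L (F c) z -> z != c ->
  (forall k, `|adj (F c - F z) k| <= `|adj (F c - F z) kmax|) ->
  kmax \in supp c /\ kmax \notin L.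
Proof.
move=> cM Lc zL nz zc kP; pose w := c - z.
have wc : supp w \subset supp c.
  apply/suppP => k kc; rewrite !ffunE (suppP _ _ (subset_trans zL Lc)) // subr0.
  by move: kc; rewrite inE negbK => /eqP.
have wn0 : w != 0 by rewrite subr_eq0 eq_sym.
have [k0 k0c [h0 hP]] := sparse_dominant wc cM wn0.
rewrite FXmulB in h0 hP; split.
  by apply: contraT => /hP lt1; have := lt_le_trans lt1 (kP k0); rewrite ltxx.
apply/negP => /nz h1; have := lt_le_trans h0 (kP k0).
by rewrite h1 normr0 ltxx.
Qed.

Lemma exact_of_residual0 c z : (#|supp c| <= M)%N -> (#|supp z| <= M)%N ->
  l2norm (F c - F z) <= l2norm (F c - F c) -> z = c.
Proof.
move=> cM zM; rewrite l2norm_le subrr => le0.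
have /l2sq_eq0 r0 : l2sq (F c - F z) = 0.
  apply: le_anti; rewrite l2sq_ge0 andbT; apply: le_trans le0 _.
  by rewrite /l2sq big1 // => i _; rewrite ffunE normr0 expr0n.
suff : c - z = 0 by move/eqP; rewrite subr_eq0 => /eqP ->.
apply: (@sparse_kernel (supp c :|: supp z)); first by rewrite FXmulB.
  apply/suppP => k; rewrite inE negb_or !inE !negbK => /andP[/eqP ck /eqP zk].
  by rewrite !ffunE ck zk subrr.
by apply: leq_trans (leq_card_setU _ _) _; rewrite mul2n -addnn leq_add.
Qed.

Lemma omp_recovers c Lam cs : (#|supp c| <= M)%N ->
  omp_run M (F c) Lam cs -> cs M = c.
Proof.
move=> cM [L0 [c0 run]].
(* Either [c] has been found, or every iteration so far added a new index of its support. The first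
   alternative covers supports with fewer than [M] elements. *)
suff inv l : (l <= M)%N -> [/\ (#|Lam l| <= l)%N, supp (cs l) \subset Lam l &
    cs l = c \/ [/\ Lam l \subset supp c, #|Lam l| = l & normal_eqs (Lam l) (F c) (cs l)]].
  have [_ cL [//|[Lc LM nz]]] := inv M (leqnn M).
  have LE : Lam M = supp c by apply/eqP; rewrite eqEcard Lc LM.
  apply: exact_of_residual0 => //; first by rewrite -LE in cM; apply: leq_trans (subset_leq_card cL) cM.
  by apply: (normal_eqs_least_squares cL nz).2; rewrite LE.
elim: l => [_|l IH lt_lM].
  split; rewrite ?L0 ?cards0 // ?c0.
    by apply/suppP => k _; rewrite ffunE.
  by right; split; rewrite ?sub0set ?cards0 // => k; rewrite inE.
have [Ll cL cases] := IH (ltnW lt_lM).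
have [[kmax [kP LE]] [cL' cmin]] := run l lt_lM.
have L'l : (#|Lam l.+1| <= l.+1)%N.
  by rewrite LE cardsU1; case: (kmax \notin _); rewrite ?ltnS // (leq_trans Ll).
split=> //.
(* Once found, [c] stays feasible with zero residual, and uniqueness of sparse solutions keeps it
   whatever index is added. *)
have [cl|zc] := eqVneq (cs l) c.
  left; apply: exact_of_residual0 => //.
    by apply: leq_trans (subset_leq_card cL') (leq_trans L'l lt_lM).
  by apply: cmin; rewrite LE subsetU // -cl cL orbT.
case: cases => [cl|[Lc Lcard nz]]; first by rewrite cl eqxx in zc.
have [kc kL] := omp_step cM Lc cL nz zc kP.
right; split; first by rewrite LE subUset sub1set kc.
  by rewrite LE cardsU1 kL Lcard.
exact: least_squares_normal_eqs.
Qed.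

End Recovery.

(** * Coherence of the sampling matrix *)

Section Coherence.
Variables (C : numClosedFieldType) (q d N : nat).
Hypothesis pN : prime N.

Let N0 : (0 < N)%N := prime_gt0 pN.
Local Notation om := (omega C N).

Lemma omega_expN : om ^+ N = 1.
Proof. by rewrite /omega exprAC rootCK // sqrrN expr1n. Qed.

(** A root of [1 + X + ... + X^(N - 1)] will do, because this polynomial takes the value [N] at
    [1]. *)
Lemma nontrivial_unity_root : exists2 z : C, z ^+ N = 1 & z != 1.
Proof.
pose P : {poly C} := \sum_(i < N) 'X^i.
have PE : 'X^N - 1 = ('X - 1) * P by rewrite subrX1.
have sP : size P != 1%N.
  have : size ('X^N - 1 : {poly C}) = N.+1 by rewrite size_XnsubC.
  rewrite PE; have [->|Pn0] := eqVneq P 0; first by rewrite mulr0 size_poly0.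
  rewrite size_monicM ?monicXsubC // size_XsubC => E.
  by have := prime_gt1 pN; lia.
have [z zP] := closed_rootP P sP; exists z.
  apply/eqP; rewrite -subr_eq0; have := congr1 (horner^~ z) PE.
  by rewrite !hornerE (rootP zP) mulr0 => ->.
apply: contraTneq zP => ->; rewrite rootE horner_sum.
under eq_bigr => i _ do rewrite hornerXn expr1n.
by rewrite sumr_const card_ord pnatr_eq0 -lt0n.
Qed.

(* The principal root has maximal real part among the [N]-th roots of [-1] in
   the closed upper half plane, hence differs from [-1] as soon as [N > 2]. *)
Lemma omega_neq1 : om != 1.
Proof.
rewrite /omega; set s := N.-root (-1).
have sN : s ^+ N = -1 by rewrite rootCK.
apply/negP; rewrite sqrf_eq1 => /orP[/eqP s1|/eqP s1].
  by move/eqP: sN; rewrite s1 expr1n eq_sym eqNr oner_eq0.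
(* Under the assumption [s = -1], [- y] is another [N]-th root of [-1]; maximality of the real part
   of [s] gives [Re y >= 1], hence [y = 1]. *)
have key (y : C) : y ^+ N = 1 -> 0 <= 'Im (- y) -> y = 1.
  move=> yN yI; have yn : `|y| = 1.
    by apply/eqP; rewrite -(@pexpr_eq1 _ _ N) // -normrX yN normr1.
  have := @rootC_Re_max C N (-1) (- y) N0 _ yI; rewrite -/s s1.
  rewrite exprNn yN mulr1 -s1 sN s1 => /(_ erefl).
  rewrite !raddfN /= lerN2 (Creal_ReP _ _) ?rpred1 // => Re1.
  have Re_le := leif_normC_Re_Creal y.
  have ReE : `|'Re y| = 'Re y by rewrite ger0_norm // (le_trans ler01).
  have y_real : y \is Num.real.
    by rewrite -(Re_le.2) eq_le Re_le.1 /= yn ReE.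
  have yE := Creal_ReP _ y_real; rewrite -yE; apply: le_anti; rewrite Re1 andbT -yn -ReE.
  exact: Re_le.1.
have [z zN] := nontrivial_unity_root; apply/negP; rewrite negbK; apply/eqP.
(* According to the sign of the imaginary part, [key] applies to [z] or to its conjugate. *)
have /orP[zI|zI] : (0 <= 'Im (- z)) || (0 <= 'Im z).
  rewrite raddfN oppr_ge0 orbC; exact: Creal_Im.
  exact: key.
have /(congr1 Num.conj) : z^* = 1.
  by apply: key; rewrite ?raddfN /= -?rmorphXn ?zN ?rmorph1 // Im_conj opprK.
by rewrite conjCK rmorph1.
Qed.

Lemma omega_norm : `|om| = 1.
Proof. by apply/eqP; rewrite -(@pexpr_eq1 _ _ N) // -normrX omega_expN normr1. Qed.

Lemma omega_neq0 : om != 0.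
Proof. by rewrite -normr_eq0 omega_norm oner_eq0. Qed.

Definition omega_char (a : 'F_N) : C := om ^+ a.

Lemma omega_char0 : omega_char 0 = 1.
Proof. by []. Qed.

Lemma omega_char_nat n : omega_char n%:R = om ^+ n.
Proof. by rewrite /omega_char val_Fp_nat // expr_mod // omega_expN. Qed.

Lemma omega_charD a b : omega_char (a + b) = omega_char a * omega_char b.
Proof.
by rewrite -[a]natr_Zp -[b]natr_Zp -natrD !omega_char_nat exprD.
Qed.

Lemma omega_char_nontriv : exists a, omega_char a != 1.
Proof. by exists 1%:R; rewrite omega_char_nat expr1 omega_neq1. Qed.

Lemma omega_char_int (z : int) : omega_char z%:~R = om ^ z.
Proof.
case: z => n; first exact: omega_char_nat.
have -> : om ^ Negz n = (om ^+ n.+1)^-1 by [].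
rewrite NegzE rmorphN /=; apply: (mulIf (expf_neq0 n.+1 omega_neq0)).
by rewrite /= (mulVf (expf_neq0 n.+1 omega_neq0)) -omega_char_nat -omega_charD addNr.
Qed.

Lemma gram_FX (k k' : Kidx q d) :
  gram C N k k' = \sum_(i < N) omega_char (kdotxN i k' - kdotxN i k)%:~R.
Proof.
apply: eq_bigr => i _; rewrite omega_char_int expfzDr ?omega_neq0 // mulrC /FX.
congr (_ * _); rewrite -invr_expz; set w := om ^ _.
have w1 : `|w| = 1 by rewrite /w -omega_char_int /omega_char normrX omega_norm expr1n.
by rewrite -[RHS]mul1r -(expr1n _ 2) -w1 normCKC mulfK // -normr_eq0 w1 oner_eq0.
Qed.

Lemma gram_FX_diag (k : Kidx q d) : gram C N k k = N%:R.
Proof.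
rewrite gram_FX; under eq_bigr => i _ do rewrite subrr omega_char0.
by rewrite sumr_const card_ord.
Qed.

Definition phase (k k' : Kidx q d) : {poly 'F_N} :=
  \sum_(l < d) (kcoord k' l - kcoord k l)%:~R *: 'X^(l.+1).

(** The indices [1, ..., N] of the nodes run once through the residues modulo [N], the last one
    giving [0]. *)
Lemma gram_phase (k k' : Kidx q d) :
  gram C N k k' = \sum_a omega_char (phase k k').[a].
Proof.
have inj : injective (fun i : 'I_N => (i.+1)%:R : 'F_N).
  move=> i j /(congr1 (fun a : 'F_N => nat_of_ord a)); rewrite !val_Fp_nat // => ij.
  have cases (m : 'I_N) : (m.+1 %% N = if m.+1 == N then 0 else m.+1)%N.
    have := ltn_ord m; case: eqP => [-> _|mN lt_m]; first by rewrite modnn.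
    by rewrite modn_small // ltn_neqAle lt_m andbT; apply/eqP.
  apply: val_inj; apply: succn_inj; move: ij; rewrite !cases.
  by case: eqP => [->|_]; case: eqP => [->|_].
have bij : bijective (fun i : 'I_N => (i.+1)%:R : 'F_N).
  by apply: inj_card_bij => //; rewrite card_Fp // card_ord.
rewrite gram_FX (reindex _ (onW_bij _ bij)) /=; apply: eq_bigr => i _.
congr omega_char; rewrite /phase horner_sum /kdotxN -sumrB rmorph_sum /=.
apply: eq_bigr => l _; rewrite -mulrBl rmorphM /= !hornerE; congr (_ * _).
by rewrite -pmulrn Fp_nat_mod // natrX.
Qed.

Lemma phase_coef (k k' : Kidx q d) (l : 'I_d) :
  (phase k k')`_l.+1 = (kcoord k' l - kcoord k l)%:~R.
Proof.
rewrite coef_sum (bigD1 l) //= big1 => [|j jl]; rewrite coefZ coefXn.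
  by rewrite eqxx mulr1 addr0.
by rewrite eqSS eq_sym (negPf (_ : _ != _)) ?mulr0.
Qed.

(** Coordinates range over a window of [2 q + 1 <= N] integers, so distinct frequencies stay
    distinct modulo [N]. *)
Lemma size_phase (k k' : Kidx q d) : (2 * q + 1 <= N)%N -> k != k' ->
  exists e, [/\ size (phase k k') = e.+1, (0 < e)%N & (e <= d)%N].
Proof.
move=> qN kk'.
have [l kl] : exists l, k l != k' l.
  apply/existsP; rewrite -negb_forall; apply: contra kk' => /forallP H.
  by apply/eqP/ffunP => l; apply/eqP.
have cl : (phase k k')`_l.+1 != 0.
  rewrite phase_coef /kcoord.
  have -> : (k' l)%:Z - q%:Z - ((k l)%:Z - q%:Z) = (k' l)%:Z - (k l)%:Z by ring.
  rewrite rmorphB /= -!pmulrn subr_eq0 -val_eqE /= !val_Fp_nat //.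
  have ltN (j : 'I_(2 * q + 1)) : (j < N)%N by apply: leq_trans (ltn_ord j) qN.
  by rewrite !modn_small // eq_sym.
have lt_l : (l.+1 < size (phase k k'))%N.
  by rewrite ltnNge; apply: contra cl => /leq_sizeP ->.
exists (size (phase k k')).-1; rewrite (ltn_predK lt_l); split=> //.
  by rewrite -ltnS (ltn_predK lt_l); apply: leq_ltn_trans lt_l.
rewrite -ltnS (ltn_predK lt_l).
apply: leq_trans (size_sum _ _ _) _; apply/bigmax_leqP => j _.
by apply: leq_trans (size_scale_leq _ _) _; rewrite size_polyXn !ltnS.
Qed.

Lemma coherence_bound (k k' : Kidx q d) : (2 * q + 1 <= N)%N ->
  ((d.-1) ^ 2 < N)%N -> k != k' -> `|gram C N k k'| <= d.-1%:R * sqrtC N%:R.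
Proof.
move=> qN dN kk'; have [e [se e0 ed]] := size_phase qN kk'.
(* Otherwise [N <= d], and [(d - 1)^2 < N] forces [N = 2]; then [q = 0] and there is only one
   frequency. *)
have Ne : ~~ (N %| e)%N.
  apply/negP => /(dvdn_leq e0) Ne; have N1 := prime_gt1 pN.
  have N2 : N = 2 by nia.
  have q0 : q = 0%N by lia.
  have triv (i : 'I_(2 * q + 1)) : i = 0%N :> nat by have := ltn_ord i; lia.
  by case/eqP: kk'; apply/ffunP => l; apply: val_inj; rewrite /= !triv.
rewrite gram_phase.
apply: le_trans (weil_bound pN omega_char0 omega_charD omega_char_nontriv se Ne) _.
rewrite ler_wpM2r ?sqrtC_ge0 ?ler0n // ler_nat; lia.
Qed.

End Coherence.

(** * From the size of [N] to exact recovery *)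

Theorem mainTheorem2 (C : numClosedFieldType) (q d M N : nat)
  (HN : prime N)
  (HNq : (2 * q + 1 <= N)%N)
  (HNM : ((d%:Z - 1) ^+ 2 * (2 * M%:Z - 1) ^+ 2 + 1 <= N%:Z)%R)
  (c : cvec C q d) (Hc : (#|supp c| <= M)%N) :
  let y := FXmul N c in
  ((exists (Lam : nat -> {set Kidx q d}) (cs : nat -> cvec C q d),
       omp_run M y Lam cs) /\
   (forall (Lam : nat -> {set Kidx q d}) (cs : nat -> cvec C q d),
       omp_run M y Lam cs -> cs M = c)) /\
  ((forall z : cvec C q d, FXmul N z = y -> l1norm c <= l1norm z) /\
   (forall z : cvec C q d, FXmul N z = y -> l1norm z <= l1norm c -> z = c)).
Proof.
have N0 := prime_gt0 HN.
(* Used with [m = 1] for the coherence bound and [m = 2 M - 1] for incoherence. For [d = 0] the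
   truncated [d.-1] is [0], still at most [|d - 1| = 1]. *)
have bound (m : nat) : m%:Z ^+ 2 <= (2 * M%:Z - 1) ^+ 2 -> ((d.-1 * m) ^ 2 < N)%N.
  move=> mM; rewrite -ltz_nat expnMn PoszM -!natz !natrX !natz.
  have dd : (d.-1)%:Z ^+ 2 <= (d%:Z - 1) ^+ 2 by case: (d) => [|n] //=; rewrite (_ : n.+1%:Z - 1 = n) //; lia.
  have := ler_pM (sqr_ge0 _) (sqr_ge0 _) dd mM.
  by move/le_lt_trans; apply; move: HNM; lia.
have dN : (d.-1 ^ 2 < N)%N.
  by rewrite -[d.-1]muln1; apply: bound; case: (M) => [|m] //; nia.
pose mu : C := d.-1%:R * sqrtC N%:R.
have mu0 : 0 <= mu by rewrite mulr_ge0 ?ler0n // sqrtC_ge0 ler0n.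
(* For [M > 0], cancel [mu], divide by [sqrt N] and square: what remains is
   [((d - 1) (2 M - 1))^2 < N]. *)
have inc : (2 * M)%:R * mu < N%:R + mu.
  case: (M) bound => [|m] bound; first by rewrite mul0r ltr_wpDr // ltr0n.
  have s0 : 0 < sqrtC (N%:R : C) by rewrite sqrtC_gt0 ltr0n.
  rewrite (_ : (2 * m.+1 = (2 * m).+1 + 1)%N) ?natrD ?mulrDl ?mul1r ?ltrD2r; last by lia.
  rewrite -[X in _ < X]sqrtCK expr2 /mu mulrA ltr_pM2r // -natrM mulnC.
  rewrite -(@ltr_pXn2r _ 2) ?nnegrE ?ler0n ?(ltW s0) // sqrtCK -natrX ltr_nat.
  by apply: bound; rewrite (_ : 2 * m.+1%:Z - 1 = (2 * m).+1%:Z) //; lia.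
have gd := @gram_FX_diag C q d N HN.
have go (k k' : Kidx q d) : k != k' -> `|gram C N k k'| <= mu.
  exact: coherence_bound.
split; split.
- exact: omp_run_exists.
- by move=> Lam cs; apply: (omp_recovers mu0 N0 gd go inc).
- move=> z Fz; have [-> //|zc] := eqVneq z c.
  exact: ltW (basis_pursuit_unique mu0 N0 gd go inc Hc Fz zc).
move=> z Fz le; have [//|zc] := eqVneq z c.
by have := lt_le_trans (basis_pursuit_unique mu0 N0 gd go inc Hc Fz zc) le; rewrite ltxx.
Qed.
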